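(* Let $7\le n\le 30$. Then there exist real constants $c_{i,j}$ ($0\le i,j\le2$) and a constant $C(n)>0$ independent of $\lambda$ such that, for every smooth solution $u$ of $\Delta^3u=0$ in $\mathbb{R}^n$ and every $x\in\mathbb{R}^n$, the function $$E^c_\infty(\lambda,x,u):=E_\infty(\lambda,x,u)-\int_{\partial B_1}\Big(\sum_{0\le i,j\le 2}c_{i,j}\lambda^{i+j}\frac{d^iu^\lambda}{d\lambda^i}\frac{d^ju^\lambda}{d\lambda^j}\Big)$$ is nondecreasing in $\lambda>0$, and moreover $$\frac{dE^c_\infty(\lambda,x,u)}{d\lambda}\ge C(n)\lambda^{-n}\int_{\partial B_\lambda(x)}(\lambda\partial_ru)^2 .$$
   Context: $B_1$ is the unit ball of $\mathbb{R}^n$ centered at $0$, $B_\lambda(x)$ the ball of radius $\lambda$ centered at $x$; $\partial_r$ is the radial derivative with respect to the center $x$; $u^\lambda(y)=u(x+\lambda y)$; $\nabla_\theta$ and $\Delta_\theta=\mathrm{div}_\theta\nabla_\theta$ are the gradient and Laplace-Beltrami operator of the unit sphere $\partial B_1$; $\Delta u^\lambda$ is the Euclidean Laplacian of $u^\lambda$ in $y$. $E_\infty$ is the formal limit $p\to\infty$ of the monotonicity functional of the triharmonic Lane-Emden equation, with the $|u|^{p+1}$ term dropped. Explicitly, with $\delta_1=2(n-1)$, $\delta_2=(n-1)(n-3)$, $f=u^\lambda$ and $'$ denoting $\frac{d}{d\lambda}$ at fixed $y$, $$\begin{aligned}E_\infty(\lambda,x,u)=&\ \lambda^{6-n}\int_{B_\lambda(x)}\tfrac12|\nabla\Delta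 u|^2\\&+\int_{\partial B_1}\Big\{(\Delta u^\lambda)^2-\lambda^5f''''f'+2\lambda^5f'''f''-(\delta_1-6)\lambda^4f'''f'-(24-6\delta_1+\delta_2)\lambda^3f''f'\\&\quad-(9\delta_1-3\delta_2-36)\lambda^2(f')^2+(\delta_1-8)\lambda^4(f'')^2+2(\Delta_\theta f)^2+\tfrac12\lambda\tfrac{d}{d\lambda}(\Delta_\theta f)^2\\&\quad+4(n-4)|\nabla_\theta f|^2+(n-4)\lambda\tfrac{d}{d\lambda}|\nabla_\theta f|^2-6\lambda^2|\nabla_\theta f'|^2+\lambda^3\tfrac{d}{d\lambda}|\nabla_\theta f'|^2\Big\}.\end{aligned}$$ *)

(* Defs.v *)
From HB Require Import structures.
From mathcomp Require Import all_boot all_order all_algebra.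
From mathcomp Require Import all_classical all_reals all_analysis.
From mathcomp Require Import measurable_realfun.

Set Implicit Arguments.
Unset Strict Implicit.
Unset Printing Implicit Defensive.

Import Order.TTheory GRing.Theory Num.Theory.
Import numFieldNormedType.Exports.

Local Open Scope classical_set_scope.
Local Open Scope ring_scope.

(* R^n is 'rV[R]_n.  The library norm on it is the sup norm (same topology,
   hence same notions of continuity and derivative); the Euclidean inner
   product, norm, balls and spheres are defined separately. *)

Section euclidean.
Context {R : realType} {n : nat}.
Implicit Types x y : 'rV[R]_n.

Definition edot x y : R := \sum_(i < n) x ord0 i * y ord0 i.

Definition enorm x : R := Num.sqrt (edot x x).

Definition eball x (r : R) : set 'rV[R]_n := [set y | enorm (y - x) < r].

Definition esphere x (r : R) : set 'rV[R]_n := [set y | enorm (y - x) = r].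

End euclidean.

(* 'rV[R]_n carries the sigma-algebra generated by the coordinates, i.e. the
   Borel sigma-algebra. *)
Section measurable_rV.
Context {R : realType} (n : nat).

Let coor (i : 'I_n) (x : 'rV[R]_n) : measurableTypeR R := x ord0 i.

Let rV_set0 : g_sigma_preimage coor set0.
Proof. exact: sigma_algebra0. Qed.

Let rV_setC A : g_sigma_preimage coor A -> g_sigma_preimage coor (~` A).
Proof. exact: sigma_algebraC. Qed.

Let rV_bigcup (F : (set 'rV[R]_n)^nat) :
  (forall i, g_sigma_preimage coor (F i)) ->
  g_sigma_preimage coor (\bigcup_i (F i)).
Proof. exact: sigma_algebra_bigcup. Qed.

HB.instance Definition _ := @isMeasurable.Build default_measure_display
  'rV[R]_n (g_sigma_preimage coor) rV_set0 rV_setC rV_bigcup.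

Lemma measurable_coor (i : 'I_n) :
  measurable_fun [set: 'rV[R]_n] (fun x : 'rV[R]_n => x ord0 i : measurableTypeR R).
Proof.
move=> _ Y mY; rewrite setTI; apply: sub_sigma_algebra => /=.
rewrite -bigcup_seq/=; exists i => /=; first by rewrite mem_index_enum.
by exists Y => //; rewrite setTI.
Qed.

Lemma measurable_fun_rVP d (T : measurableType d) (f : T -> 'rV[R]_n) :
  (forall i, measurable_fun [set: T] (fun x => f x ord0 i : measurableTypeR R)) ->
  measurable_fun [set: T] f.
Proof.
move=> mf.
suff H : g_sigma_preimage (fun i => coor i \o f) `<=` measurable.
  by move: H; rewrite g_sigma_preimage_comp => H _ A mA; apply: H; exists A.
apply: smallest_sub; first exact: sigma_algebra_measurable.
rewrite -bigcup_seq => A [i _] [B mB <-].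
exact: mf.
Qed.

End measurable_rV.

Section lebesgue_rV.
Context {R : realType}.

Definition consrV n (p : measurableTypeR R * 'rV[R]_n) : 'rV[R]_n.+1 :=
  row_mx (const_mx p.1 : 'rV[R]_1) p.2.

Definition unconsrV n (v : 'rV[R]_n.+1) : measurableTypeR R * 'rV[R]_n :=
  (v ord0 ord0, \row_j v ord0 (lift ord0 j)).

Lemma measurable_consrV n : measurable_fun setT (@consrV n).
Proof.
apply: measurable_fun_rVP => i.
have [j ->|j ->] := split_ordP (i : 'I_(1 + n)).
- rewrite (_ : (fun _ => _) = fst) //; apply/funext => -[a v] /=.
  by rewrite /consrV (row_mxEl (const_mx a : 'rV_1)) mxE.
- rewrite (_ : (fun _ => _) = (fun v : 'rV[R]_n => v ord0 j) \o snd).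
    exact: measurableT_comp (measurable_coor j) measurable_snd.
  by apply/funext => -[a v] /=; rewrite /consrV (row_mxEr (const_mx a : 'rV_1)).
Qed.

Lemma measurable_unconsrV n : measurable_fun setT (@unconsrV n).
Proof.
apply: measurable_fun_pair.
  exact: (measurable_coor ord0).
apply: measurable_fun_rVP => i.
rewrite (_ : (fun _ => _) = (fun v : 'rV[R]_n.+1 => v ord0 (lift ord0 i))).
  exact: measurable_coor.
by apply/funext => v; rewrite mxE.
Qed.

Lemma consrVK n : cancel (@consrV n) (@unconsrV n).
Proof.
move=> [a v]; rewrite /unconsrV /consrV /=; congr pair.
  transitivity ((const_mx a : 'rV[R]_1) ord0 ord0); last by rewrite mxE.
  rewrite -(row_mxEl (const_mx a : 'rV_1) v).
  by congr (row_mx _ _ _ _); exact/val_inj.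
apply/rowP => j; rewrite mxE -(row_mxEr (const_mx a : 'rV_1) v).
by congr (row_mx _ _ _ _); exact/val_inj.
Qed.

Section step.
Variables (n : nat) (m : {sigma_finite_measure set 'rV[R]_n -> \bar R}).

Definition lebesgue_rV_step : set 'rV[R]_n.+1 -> \bar R :=
  pushforward (@lebesgue_measure R \x m)%E (@consrV n).

Let mc := @measurable_consrV n.

Let step0 : lebesgue_rV_step set0 = 0%E.
Proof. by rewrite /lebesgue_rV_step /pushforward preimage_set0 measure0. Qed.

Let step_ge0 A : (0 <= lebesgue_rV_step A)%E.
Proof. exact: measure_ge0. Qed.

Let step_sigma_additive : semi_sigma_additive lebesgue_rV_step.
Proof. exact: measure_semi_sigma_additive. Qed.

HB.instance Definition _ := isMeasure.Build _ _ _ lebesgue_rV_step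
  step0 step_ge0 step_sigma_additive.

Let step_sigma_finite : sigma_finite setT lebesgue_rV_step.
Proof.
have /sigma_finiteP[F [TF ndF Foo]] := sigma_finiteT (@lebesgue_measure R).
have /sigma_finiteP[G [TG ndG Goo]] := sigma_finiteT m.
exists (fun k => @unconsrV n @^-1` (F k `*` G k)).
  rewrite -preimage_bigcup (_ : \bigcup_k _ = setT) ?preimage_setT//.
  rewrite -subTset => -[x y] _.
  have [/= i _ Fx] : (\bigcup_k F k) x by rewrite -TF.
  have [/= j _ Gy] : (\bigcup_k G k) y by rewrite -TG.
  exists (maxn i j) => //; split => /=.
    by move: x Fx; exact/subsetPset/ndF/leq_maxl.
  by move: y Gy; exact/subsetPset/ndG/leq_maxr.
move=> k; have [mF Fk] := Foo k; have [mG Gk] := Goo k; split.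
  rewrite -[X in measurable X]setTI; apply: measurable_unconsrV => //.
  exact: measurableX.
rewrite /lebesgue_rV_step /pushforward (_ : _ @^-1` _ = F k `*` G k); last first.
  by rewrite -comp_preimage (_ : _ \o _ = id)//; exact/funext/consrVK.
by rewrite product_measure1E// lte_mul_pinfty// ge0_fin_numE.
Qed.

HB.instance Definition _ := Measure_isSigmaFinite.Build _ _ _ lebesgue_rV_step
  step_sigma_finite.

End step.

Fixpoint lebesgue_rV n : {sigma_finite_measure set 'rV[R]_n -> \bar R} :=
  match n with
  | 0%N => \d_(0 : 'rV[R]_0)
  | k.+1 => lebesgue_rV_step (lebesgue_rV k)
  end.

End lebesgue_rV.

(* Surface measure of the unit sphere: the measure of a Borel subset A is n
   times the volume of the cone {t a | a in A, 0 < t < 1}.  Integrals against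
   it are always taken over esphere 0 1. *)
Section sphere_measure.
Context {R : realType} (n : nat).

Definition udir (y : 'rV[R]_n) : 'rV[R]_n := (enorm y)^-1 *: y.

Lemma edot_ge0 (y : 'rV[R]_n) : 0 <= edot y y.
Proof. by apply: sumr_ge0 => i _; rewrite -expr2 sqr_ge0. Qed.

Lemma measurable_enorm (x : 'rV[R]_n) :
  measurable_fun setT (fun y : 'rV[R]_n => enorm (y - x) : measurableTypeR R).
Proof.
rewrite (_ : (fun _ => _) = fun y : 'rV[R]_n => edot (y - x) (y - x) `^ 2^-1).
  apply: (measurableT_comp (measurable_powR _)).
  apply: measurable_sum => i.
  by apply: measurable_funM; under eq_fun do rewrite !mxE;
    apply: measurable_funB => //; exact: measurable_coor.
by apply/funext => y; rewrite powR12_sqrt// edot_ge0.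
Qed.

Lemma measurable_udir : measurable_fun setT udir.
Proof.
apply: measurable_fun_rVP => i.
rewrite (_ : (fun _ => _) = fun y : 'rV[R]_n => (enorm (y - 0)) `^ (- 1) * y ord0 i).
  apply: measurable_funM; last exact: measurable_coor.
  exact: (measurableT_comp (measurable_powR _) (measurable_enorm 0)).
by apply/funext => y; rewrite mxE subr0 powR_inv1// sqrtr_ge0.
Qed.

Lemma measurable_eball (x : 'rV[R]_n) r : measurable (eball x r).
Proof.
rewrite -[X in measurable X]setTI (_ : eball x r =
    (fun y : 'rV[R]_n => enorm (y - x)) @^-1` `]-oo, r[%classic).
  by apply: measurable_enorm => //; exact: measurable_itv.
by apply/seteqP; split=> y /=; rewrite in_itv.
Qed.

Definition sphere_measure (A : set 'rV[R]_n) : \bar R :=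
  (n%:R%:E * lebesgue_rV n (eball 0 1 `&` udir @^-1` A))%E.

Let sphere0 : sphere_measure set0 = 0%E.
Proof. by rewrite /sphere_measure preimage_set0 setI0 measure0 mule0. Qed.

Let sphere_ge0 A : (0 <= sphere_measure A)%E.
Proof. by rewrite mule_ge0// lee_fin. Qed.

Let sphere_sigma_additive : semi_sigma_additive sphere_measure.
Proof.
move=> F mF tF mUF; rewrite /sphere_measure preimage_bigcup setI_bigcupr.
under eq_fun do rewrite -ge0_sume_distrr//.
apply: cvgeZl => //.
have mpre A : measurable A -> measurable (eball 0 1 `&` udir @^-1` A).
  move=> mA; apply: measurableI; first exact: measurable_eball.
  by rewrite -[X in measurable X]setTI; exact: measurable_udir.
apply: measure_semi_sigma_additive.
- by move=> k; exact: mpre.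
- apply/trivIsetP => i j _ _ ij; have /trivIsetP/(_ i j I I ij) Fij := tF.
  rewrite -subset0 => y [[_ Fiy] [_ Fjy]].
  have : (F i `&` F j) (udir y) by split.
  by rewrite Fij.
- by rewrite -setI_bigcupr -preimage_bigcup; exact: mpre.
Qed.

HB.instance Definition _ := isMeasure.Build _ _ _ sphere_measure
  sphere0 sphere_ge0 sphere_sigma_additive.

End sphere_measure.

Section calculus.
Context {R : realType} {n : nat}.
Implicit Types (u g : 'rV[R]_n -> R) (x y : 'rV[R]_n).

Definition partial (i : 'I_n) u y : R := 'D_(delta_mx ord0 i) u y.

Definition smooth u := forall s : seq 'I_n,
  continuous (foldr partial u s) /\
  forall i y, derivable (foldr partial u s) y (delta_mx ord0 i).

Definition grad u y : 'rV[R]_n := \row_i partial i u y.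

Definition laplacian u y : R := \sum_(i < n) partial i (partial i u) y.

Definition radial_derivative x u y : R := 'D_(udir (y - x)) u y.

(* For y on the unit sphere, the gradient on the sphere of the restriction of
   g: the component of the Euclidean gradient tangent to the sphere at y. *)
Definition sphere_grad g y : 'rV[R]_n := grad g y - edot (grad g y) y *: y.

(* For y on the unit sphere and X tangent to it, the divergence on the sphere:
   the trace of the tangential derivative of X.  As for sphere_grad, the value
   does not depend on the extension of X outside the sphere, so sphere_grad g
   need not be normalized there. *)
Definition sphere_div (X : 'rV[R]_n -> 'rV[R]_n) y : R :=
  \sum_(i < n) sphere_grad (fun z => X z ord0 i) y ord0 i.

Definition sphere_laplacian g : 'rV[R]_n -> R := sphere_div (sphere_grad g).

(* Integral of g over esphere x r: a dilation by r multiplies the surface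
   measure by r ^+ n.-1. *)
Definition surface_integral x (r : R) g : R :=
  r ^+ n.-1 *
  \int[@sphere_measure R n]_(y in esphere 0 1) g (x + r *: y).

End calculus.

Section monotonicity.
Context {R : realType} {n : nat}.
Implicit Types (u : 'rV[R]_n -> R) (x y : 'rV[R]_n) (l : R).

(* u^lambda, with center x. *)
Definition blowup u x l y : R := u (x + l *: y).

Definition dlambda (f : R -> 'rV[R]_n -> R) (k : nat) l y : R :=
  derive1n k (fun t : R => f t y) l.

Definition delta1 : R := 2 * (n%:R - 1).
Definition delta2 : R := (n%:R - 1) * (n%:R - 3).

Definition Einf_boundary u x l y : R :=
  let f := blowup u x in
  let d k := dlambda f k l y in
  let lap t := sphere_laplacian (f t) y ^+ 2 in
  let nab t := enorm (sphere_grad (f t) y) ^+ 2 in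
  let nab' t := enorm (sphere_grad (dlambda f 1 t) y) ^+ 2 in
  laplacian (f l) y ^+ 2
  - l ^+ 5 * d 4%N * d 1%N
  + 2 * l ^+ 5 * d 3%N * d 2%N
  - (delta1 - 6) * l ^+ 4 * d 3%N * d 1%N
  - (24 - 6 * delta1 + delta2) * l ^+ 3 * d 2%N * d 1%N
  - (9 * delta1 - 3 * delta2 - 36) * l ^+ 2 * d 1%N ^+ 2
  + (delta1 - 8) * l ^+ 4 * d 2%N ^+ 2
  + 2 * lap l + 2^-1 * l * derive1 lap l
  + 4 * (n%:R - 4) * nab l + (n%:R - 4) * l * derive1 nab l
  - 6 * l ^+ 2 * nab' l + l ^+ 3 * derive1 nab' l.

(* The powers of lambda include 6 - n, negative for n > 6, hence the int
   exponent. *)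
Definition Einf l x u : R :=
  l ^ (6 - n%:Z) *
    (\int[@lebesgue_rV R n]_(z in eball x l)
       (2^-1 * enorm (grad (laplacian u) z) ^+ 2))
  + \int[@sphere_measure R n]_(y in esphere 0 1) Einf_boundary u x l y.

Definition Einf_corrected (c : 'I_3 -> 'I_3 -> R) l x u : R :=
  Einf l x u
  - \int[@sphere_measure R n]_(y in esphere 0 1)
      (\sum_(i < 3) \sum_(j < 3)
         c i j * l ^+ (i + j)%N *
         dlambda (blowup u x) i l y * dlambda (blowup u x) j l y).

End monotonicity.

(* Main.v *)
From HB Require Import structures.
Require Import Defs.
From mathcomp Require Import all_boot all_order all_algebra.
From mathcomp Require Import all_classical all_reals all_analysis.
From mathcomp Require Import measurable_realfun ring lra zify.

Set Implicit Arguments.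
Unset Strict Implicit.
Unset Printing Implicit Defensive.

Import Order.TTheory GRing.Theory Num.Theory.
Import numFieldNormedType.Exports.

Local Open Scope classical_set_scope.
Local Open Scope ring_scope.

(* Put v(y) = u(x + y), E = sum y_i d_i and let L be the spherical Laplacian
   extended to R^n by |y|^2 Delta = E^2 + (n-2) E + L, so that E and L commute.
   Writing M(g) for the integral over the unit sphere of g(l y), one has
   l dM(g)/dl = M(E g), and M vanishes on rotation derivatives
   (y_i d_j - y_j d_i) g, hence M(Gam(f,g) + f L g) = 0 where Gam is the
   tangential gradient product.  Applying the same equation three times to
   Delta^3 v = 0 turns the volume term into a sphere mean: l times its
   derivative is M of an explicit flux.  So l dE^c/dl = M(Q) for a quadratic
   expression Q in p = E v, q = E p, r = E q, s = L p modulo terms of zero mean.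
   The correction has three free weights; they remove the p q and q r terms and
   tune the p r term, after which Q >= p^2 pointwise for 7 <= n <= 30, and
   p = l d_r u. *)

(** * Functions with continuous partial derivatives *)

Section c1.
Context {R : realType}.

(** The obstacle is integration by parts on spheres and balls when surface measure is known only as
    the volume of cones. Charts, the divergence theorem and polar coordinates are avoided:
    tangential integration by parts comes from rotation invariance, hence from the invariance of
    Lebesgue measure under isometries, and ball integrals are differentiated by comparison with
    functions homogeneous of degree 0. What remains is algebra in the commutative ring of smooth
    functions on [R^n], governed by the commutation rules of E, L and the multiplication by [|y|^2].

    The flux is the boundary integrand left by three integrations by parts in the integral of
    [grad (Delta v) . grad (Delta (E v))], the first variation of the volume term under scaling.
    Integrating its derivative back needs a primitive vanishing at radius 0, which [n > 6] provides
    through the factor [l^(n-6)].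

    The bound 30 comes from the weight [t] of [p r]: positivity asks for [t >= n^2 - 24 n + 68] and
    [3 t^2 / 32 <= 8 (n-2) (n-4) - 1]. For [n = 30] this is [248 <= t] with [t] at most about 249.2;
    for [n = 31] it would be [285 <= t] with [t < 259]. *)

Lemma is_derive_line (V : normedModType R) (f : V -> R) (y v : V) (t : R) :
  derivable f (y + t *: v) v ->
  is_derive t 1 (fun s : R => f (y + s *: v)) ('D_v f (y + t *: v)).
Proof.
move=> df.
have E : (fun h : R => h^-1 *: (((fun s : R => f (y + s *: v)) \o shift t) (h *: 1)
            - f (y + t *: v)))
       = (fun h : R => h^-1 *: ((f \o shift (y + t *: v)) (h *: v) - f (y + t *: v))).
  apply/funext => h /=; congr (_ *: (f _ - _)).
  by rewrite [h *: 1]mulr1 scalerDl addrCA.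
by apply: DeriveDef; rewrite /derivable /derive /= E.
Qed.

(** Keeping only [|c| <= |h|] removes the sign of [h] from later arguments: for [h < 0] the mean
    value theorem is applied on [[h, 0]]. *)
Lemma mvt_from0 (g dg : R -> R) (h : R) :
  (forall x : R, is_derive x 1 g (dg x)) ->
  exists2 c, `|c| <= `|h| & g h - g 0 = dg c * h.
Proof.
move=> dgP.
have cg a b : {within `[a, b], continuous g}.
  by apply: derivable_within_continuous => x _; exact: ex_derive.
have [h0|h0] := leP 0 h.
  have [|c] := MVT_segment h0 (fun x _ => dgP x); first exact: cg.
  rewrite in_itv/= => /andP[c0 ch] ->; exists c; last by rewrite subr0.
  by rewrite !ger0_norm.
have [|c] := MVT_segment (ltW h0) (fun x _ => dgP x); first exact: cg.
rewrite in_itv/= => /andP[hc c0]; rewrite sub0r => E; exists c.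
  by rewrite (ltr0_norm h0) ler0_norm// lerN2.
by rewrite -opprB E mulrN opprK.
Qed.

Variable n : nat.
Implicit Types (f : 'rV[R]_n -> R) (x h : 'rV[R]_n).

(** Vertices of a staircase from 0 to [h], each step being parallel to one axis. *)
Definition trunc_row (k : nat) h : 'rV[R]_n :=
  \row_i (if (i < k)%N then h ord0 i else 0).

Lemma trunc_rowS (k : 'I_n) h :
  trunc_row k.+1 h = trunc_row k h + h ord0 k *: delta_mx ord0 k.
Proof.
apply/rowP => i; rewrite !mxE eqxx/= ltnS leq_eqVlt.
have [->|ik] := eqVneq i k; first by rewrite eqxx ltnn mulr1 add0r.
by rewrite (_ : _ == _ = false) ?mulr0 ?addr0//; apply/negbTE.
Qed.

Lemma row_norm_le (y : 'rV[R]_n) (r : R) : 0 <= r ->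
  (forall i, `|y ord0 i| <= r) -> `|y| <= r.
Proof.
move=> r0 yr; rewrite [`|y|]mx_normrE.
apply: bigmax_le => // -[i j] _ /=; rewrite (ord1 i); exact: yr.
Qed.

Lemma coor_norm_le (y : 'rV[R]_n) i : `|y ord0 i| <= `|y|.
Proof.
rewrite [X in _ <= X]mx_normrE.
exact: (le_bigmax_cond _ (fun ij : 'I_1 * 'I_n => `|y ij.1 ij.2|) (j := (ord0, i))).
Qed.

(** The increment telescopes along the staircase, and each step is a one-variable increment. The
    intermediate point varies with the step, so only its distance to [x] is recorded. *)
Lemma mvt_row f : (forall i y, derivable f y (delta_mx ord0 i)) ->
  forall x h, exists xi : 'I_n -> 'rV[R]_n, (forall i, `|xi i| <= `|h|) /\
    f (x + h) - f x = \sum_(i < n) h ord0 i * partial i f (x + xi i).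
Proof.
move=> df x h.
have step (k : 'I_n) : exists y : 'rV[R]_n, `|y| <= `|h| /\
    f (x + trunc_row k.+1 h) - f (x + trunc_row k h)
    = h ord0 k * partial k f (x + y).
  pose e : 'rV[R]_n := delta_mx ord0 k.
  have [c ch E] := mvt_from0 (h ord0 k)
     (fun t => is_derive_line (df k (x + trunc_row k h + t *: e))).
  exists (trunc_row k h + c *: e); split.
    apply: row_norm_le => // i; rewrite !mxE eqxx/=.
    have [->|ik] := eqVneq i k.
      by rewrite ltnn add0r mulr1 (le_trans ch)// coor_norm_le.
    rewrite mulr0 addr0; case: ifP => _; rewrite ?normr0//.
    exact: coor_norm_le.
  by move: E; rewrite scale0r addr0 trunc_rowS addrA => ->; rewrite addrA mulrC.
have /choice[xi xiP] := step.
exists xi; split; first by move=> i; have [] := xiP i.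
under eq_bigr do rewrite -(xiP _).2.
rewrite -(big_mkord xpredT (fun k => f (x + trunc_row k.+1 h) - f (x + trunc_row k h))).
rewrite telescope_sumr//; congr (f _ - f _).
  by congr (_ + _); apply/rowP => i; rewrite mxE ltn_ord.
by rewrite (_ : trunc_row 0 h = 0) ?addr0//; apply/rowP => i; rewrite !mxE.
Qed.

Lemma c1_near f x : (forall i, continuous (partial i f)) ->
  forall e : R, 0 < e -> exists2 d : R, 0 < d &
   forall y, `|y| < d -> forall i, `|partial i f (x + y) - partial i f x| <= e.
Proof.
move=> cf e e0.
have : \forall y \near x, forall i, `|partial i f y - partial i f x| <= e.
  apply: (@filter_forall _ _ (fun i y => `|partial i f y - partial i f x| <= e) _ (nbhs_filter x)) => i.
  by have /cvgrPdist_le/(_ e e0) := cf i x; apply: filterS => y; rewrite distrC.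
rewrite -nbhs_nearE => /nbhs_ballP[d /= d0 xd].
exists d => // y yd i; apply: xd; rewrite -ball_normE/=.
by rewrite opprD addNKr normrN.
Qed.

Lemma sum_coor_continuous (a : 'I_n -> R) :
  continuous (fun h : 'rV[R]_n => \sum_(i < n) h ord0 i * a i).
Proof.
apply: continuous_big => [|i _ h]; first exact: add_continuous.
by apply: continuousM; [exact: (@coord_continuous R _ _ ord0 i h)|exact: cst_continuous].
Qed.

(** By [mvt_row] the error of the linear approximation is a sum of coordinates of [h] times
    oscillations of partial derivatives near [x], and these are small by continuity. *)
Lemma c1_differentiable f :
  (forall i y, derivable f y (delta_mx ord0 i)) ->
  (forall i, continuous (partial i f)) ->
  forall x, differentiable f x /\
    forall v, 'D_v f x = \sum_(i < n) v ord0 i * partial i f x.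
Proof.
move=> df cf x.
pose d h := \sum_(i < n) h ord0 i * partial i f x.
have d_lin : linear d.
  move=> k u v; rewrite /d /= scaler_sumr -big_split/=; apply: eq_bigr => i _.
  by rewrite !mxE mulrDl -mulrA.
pose dM := GRing.isLinear.Build _ _ _ _ _ d_lin.
pose dL : {linear _ -> _} := HB.pack d dM.
have dc : continuous d by exact: sum_coor_continuous.
have fd : (f : 'rV[R]_n -> R^o) \o shift x =
    cst (f x : R^o) + (dL : 'rV[R]_n -> R^o) +o_ (nbhs (0 : 'rV[R]_n)) (id : 'rV[R]_n -> 'rV[R]_n).
  apply/eqaddoP => _/posnumP[e]; rewrite /=.
  (* Dividing by [n + 1] rather than [n] also covers dimension 0. *)
  have e'0 : 0 < e%:num / n.+1%:R by [].
  have [r r0 rP] := c1_near x cf e'0.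
  have rn : nbhs (0 : 'rV[R]_n) (fun h => `|h| < r).
    apply/nbhs_ballP; exists r => // h.
    by rewrite -ball_normE/= sub0r normrN.
  apply: filterS rn => h hr.
  have [xi [xih E]] := mvt_row df x h.
  rewrite /= -![(_ + _ : _ -> _) _]/(_ + _) -![(- _ : _ -> _) _]/(- _) /=.
  rewrite -[(_ + _ : _ -> _) _]/(_ + _) /cst/= opprD addrA (addrC h x) E /d -sumrB.
  apply: (le_trans (ler_norm_sum _ _ _)).
  apply: (@le_trans _ _ (\sum_(i < n) e%:num / n.+1%:R * `|h|)).
    apply: ler_sum => i _; rewrite -mulrBr normrM mulrC.
    apply: ler_pM => //; last exact: coor_norm_le.
    apply: rP; exact: le_lt_trans (xih i) hr.
  rewrite sumr_const card_ord -[leLHS]mulr_natr mulrAC.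
  apply: ler_wpM2r => //; rewrite -mulrA ler_piMr//.
  by rewrite ler_pdivrMl// mulr1 ler_nat.
have E : 'd f x = dL :> (_ -> _) by apply: diff_unique.
have fdiff : differentiable f x by apply/diff_locallyP; rewrite E.
split=> // v.
by rewrite deriveE// E.
Qed.

Lemma is_derive_curve f : (forall i y, derivable f y (delta_mx ord0 i)) ->
  (forall i, continuous (partial i f)) ->
  forall (g : R -> 'rV[R]_n) (dg : 'rV[R]_n) (t : R),
  (forall i, is_derive t 1 (fun s => g s ord0 i) (dg ord0 i)) ->
  is_derive t 1 (f \o g) (\sum_(i < n) dg ord0 i * partial i f (g t)).
Proof.
move=> df cf g dg t gP.
have dgt : derivable g t 1.
  by apply/derivable_mxP => i j; rewrite (ord1 i); have [] := gP j.
have gE : 'D_1 g t = dg.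
  rewrite derive_mx//; apply/rowP => i; rewrite mxE.
  by have [_ <-] := gP i.
have [fd fE] := c1_differentiable df cf (g t).
have gd : differentiable g t by apply/derivable1_diffP.
have fgd : differentiable (f \o g) t by exact: differentiable_comp.
apply: DeriveDef; first exact/derivable1_diffP.
by rewrite deriveE// diff_comp//= -[X in 'd f _ X]deriveE// gE -deriveE// fE.
Qed.

(* Applied with [i] and [j] exchanged, this evaluates the same second difference
   in two ways, whence Schwarz's theorem. *)
Lemma second_difference f : (forall i y, derivable f y (delta_mx ord0 i)) ->
  (forall i j y, derivable (partial i f) y (delta_mx ord0 j)) ->
  forall x i j (h : R), 0 < h -> exists2 y : 'rV[R]_n, `|y| <= h *+ 2 &
    f (x + h *: delta_mx ord0 i + h *: delta_mx ord0 j)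
    - f (x + h *: delta_mx ord0 i) - f (x + h *: delta_mx ord0 j) + f x
    = h ^+ 2 * partial j (partial i f) (x + y).
Proof.
move=> df ddf x i j h h0.
pose ei : 'rV[R]_n := delta_mx ord0 i; pose ej : 'rV[R]_n := delta_mx ord0 j.
have e1 k : `|delta_mx ord0 k : 'rV[R]_n| <= 1.
  by apply: row_norm_le => // l; rewrite mxE eqxx/=; case: eqP => _; rewrite ?normr1 ?normr0.
pose g (s : R) := f (x + h *: ej + s *: ei) - f (x + s *: ei).
pose dg (s : R) := partial i f (x + h *: ej + s *: ei) - partial i f (x + s *: ei).
have gP (s : R) : is_derive s 1 g (dg s).
  by apply: is_deriveB; exact: is_derive_line (df _ _).
have [c ch gE] := mvt_from0 h gP.
pose k (s : R) := partial i f (x + c *: ei + s *: ej).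
have kP (s : R) : is_derive s 1 k (partial j (partial i f) (x + c *: ei + s *: ej)).
  exact: is_derive_line (ddf _ _ _).
have [c' ch' kE] := mvt_from0 h kP.
exists (c *: ei + c' *: ej).
  rewrite mulr2n (le_trans (ler_normD _ _))// lerD// normrZ.
  - rewrite -[leRHS]mulr1; apply: ler_pM => //; last exact: e1.
    by apply: le_trans ch _; rewrite gtr0_norm.
  - rewrite -[leRHS]mulr1; apply: ler_pM => //; last exact: e1.
    by apply: le_trans ch' _; rewrite gtr0_norm.
transitivity (g h - g 0).
  by rewrite /g scale0r !addr0 (addrAC x (h *: ej)); ring.
have dgE : dg c = k h - k 0.
  by rewrite /dg /k scale0r addr0 (addrAC x (h *: ej)).
by rewrite gE dgE kE addrA; ring.
Qed.

Lemma partialC f : (forall i y, derivable f y (delta_mx ord0 i)) ->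
  (forall i j y, derivable (partial i f) y (delta_mx ord0 j)) ->
  (forall i j, continuous (partial i (partial j f))) ->
  forall i j, partial i (partial j f) = partial j (partial i f).
Proof.
move=> df ddf cf i j; apply/funext => x; apply/eqP; rewrite -subr_eq0 -normr_le0.
apply/ler_addgt0Pr => e e0; rewrite add0r.
have e20 : 0 < e / 2 by rewrite divr_gt0.
have [d1 d10 P1] := c1_near x (cf ^~ j) e20.
have [d2 d20 P2] := c1_near x (cf ^~ i) e20.
have [h h0 h2] : exists2 h : R, 0 < h & h *+ 2 < Num.min d1 d2.
  have m0 : 0 < Num.min d1 d2 by rewrite lt_min d10.
  by exists (Num.min d1 d2 / 4); move: (Num.min d1 d2) m0 => m m0; lra.
have [y yh yE] := second_difference df ddf x j i h0.
have [z zh zE] := second_difference df ddf x i j h0.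
have yd : `|y| < d1 by apply: le_lt_trans yh _; apply: lt_le_trans h2 _; rewrite ge_min lexx.
have zd : `|z| < d2 by apply: le_lt_trans zh _; apply: lt_le_trans h2 _; rewrite ge_min lexx orbT.
have {P1 yd} := P1 y yd i; have {P2 zd} := P2 z zd j; move: yE zE.
move: (partial i (partial j f)) (partial j (partial i f)) => F G.
rewrite (addrAC x (h *: delta_mx ord0 j)) => yE zE.
have h20 : h ^+ 2 != 0 by rewrite lt0r_neq0// exprn_gt0.
have -> : F (x + y) = G (x + z) by apply: (mulfI h20); rewrite -yE -zE; congr (_ + _); exact: addrAC.
move: (F x) (G x) (G (x + z)) => a b c.
rewrite !ler_norml => /andP[? ?] /andP[? ?]; apply/andP; split; lra.
Qed.

End c1.

(** * The ring of smooth functions *)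

Section smooth_closure.
Context {R : realType} {n : nat}.
Implicit Types (u v : 'rV[R]_n -> R).

(** [smooth] is the largest predicate that is stable under partial derivatives and implies
    continuity and partial differentiability, so exhibiting any such invariant suffices. *)
Lemma smooth_coind (P : ('rV[R]_n -> R) -> Prop) :
  (forall u, P u -> continuous u /\
     (forall i y, derivable u y (delta_mx ord0 i)) /\ forall i, P (partial i u)) ->
  forall u, P u -> smooth u.
Proof.
move=> PP u Pu s.
have : P (foldr partial u s).
  by elim: s => [//|i s IH] /=; have [_ [_]] := PP _ IH; apply.
by move=> /PP[? []].
Qed.

Lemma smooth_continuous u : smooth u -> continuous u.
Proof. by move=> /(_ [::])[]. Qed.

Lemma smooth_derivable u i y : smooth u -> derivable u y (delta_mx ord0 i).
Proof. by move=> /(_ [::])[_]; apply. Qed.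

Lemma smooth_partial i u : smooth u -> smooth (partial i u).
Proof. by move=> su s; have := su (rcons s i); rewrite foldr_rcons. Qed.

Lemma smooth_c1 u : smooth u -> (forall i y, derivable u y (delta_mx ord0 i)) *
  (forall i, continuous (partial i u)).
Proof.
move=> su; split=> [i y|i]; first exact: smooth_derivable.
exact/smooth_continuous/smooth_partial.
Qed.

Lemma partial_cst i (c : R) : partial i (cst c : 'rV[R]_n -> R) = cst 0.
Proof. by apply/funext => y; rewrite /partial derive_cst. Qed.

Lemma smooth_cst (c : R) : smooth (cst c : 'rV[R]_n -> R).
Proof.
apply: (@smooth_coind (fun u => exists c, u = cst c)); last by exists c.
move=> _ [k ->]; split; first exact: cst_continuous.
by split=> [i y|i]; [exact: derivable_cst|exists 0; rewrite partial_cst].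
Qed.

Lemma is_derive_coor (j i : 'I_n) (y : 'rV[R]_n) :
  is_derive y (delta_mx ord0 i) (fun z : 'rV[R]_n => z ord0 j) ((j == i)%:R : R).
Proof.
have jc : continuous (fun z : 'rV[R]_n => z ord0 j : R) := @coord_continuous R _ _ ord0 j.
apply: DeriveDef; first exact/diff_derivable/differentiable_coord.
rewrite /derive; apply/cvg_lim => //.
apply: cvg_near_cst; near=> h.
rewrite /= !mxE eqxx/= addrK -[_ *: _]/(_ * _) mulrA mulVf ?mul1r//.
by near: h; exact: nbhs_dnbhs_neq.
Unshelve. all: by end_near. Qed.

Lemma partial_coor (i j : 'I_n) :
  partial i (fun z : 'rV[R]_n => z ord0 j) = cst (j == i)%:R.
Proof.
by apply/funext => y; rewrite /partial; have [_ ->] := is_derive_coor j i y.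
Qed.

Lemma smooth_coor (j : 'I_n) : smooth (fun z : 'rV[R]_n => z ord0 j).
Proof.
apply: (@smooth_coind (fun u => smooth u \/ u = fun z => z ord0 j)); last by right.
move=> u [su|->].
  split; first exact: smooth_continuous.
  by split=> i; [move=> y; exact: smooth_derivable|left; exact: smooth_partial].
split; first exact: coord_continuous.
split=> i; last by left; rewrite partial_coor; exact: smooth_cst.
by move=> y; have [] := is_derive_coor j i y.
Qed.

Lemma partialM i u v : (forall y, derivable u y (delta_mx ord0 i)) ->
  (forall y, derivable v y (delta_mx ord0 i)) ->
  partial i (u \* v) = (partial i u \* v) \+ (u \* partial i v).
Proof.
move=> du dv; apply/funext => y; rewrite /partial deriveM//= addrC.
by congr (_ + _); exact: mulrC.
Qed.

(* The smooth functions generate a set which partial derivatives visibly preserve;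
   this is what makes the coinduction principle apply to products. *)
Inductive ring_span : ('rV[R]_n -> R) -> Prop :=
| ring_span_smooth u : smooth u -> ring_span u
| ring_spanD u v : ring_span u -> ring_span v -> ring_span (u \+ v)
| ring_spanM u v : ring_span u -> ring_span v -> ring_span (u \* v).

Lemma smooth_ring_span u : ring_span u -> smooth u.
Proof.
apply: smooth_coind => {}u.
elim=> {u}[u su|u v _ [cu [du pu]] _ [cv [dv pv]]|u v ru [cu [du pu]] rv [cv [dv pv]]].
- split; first exact: smooth_continuous.
  split=> i; first by move=> y; exact: smooth_derivable.
  by apply: ring_span_smooth; exact: smooth_partial.
- split; first by move=> y; apply: continuousD; [exact: cu|exact: cv].
  split=> i; first by move=> y; exact: derivableD.
  rewrite (_ : partial i _ = partial i u \+ partial i v); first exact: ring_spanD.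
  by apply/funext => y; rewrite /partial deriveD.
- split; first by move=> y; apply: continuousM; [exact: cu|exact: cv].
  split=> i; first by move=> y; exact: derivableM.
  by rewrite partialM//; apply: ring_spanD; exact: ring_spanM.
Qed.

Lemma is_derive_affine u (x : 'rV[R]_n) (l : R) i y : smooth u ->
  is_derive y (delta_mx ord0 i) (fun z => u (x + l *: z)) (l * partial i u (x + l *: y)).
Proof.
move=> su.
have [_ dE] := c1_differentiable (smooth_c1 su).1 (smooth_c1 su).2 (x + l *: y).
have [ud _] := c1_differentiable (smooth_c1 su).1 (smooth_c1 su).2 (x + l *: y).
have du : derivable u (x + l *: y) (l *: delta_mx ord0 i) by exact: diff_derivable.
have E : (fun h : R => h^-1 *: (((fun z : 'rV[R]_n => u (x + l *: z)) \o shift y)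
     (h *: delta_mx ord0 i) - u (x + l *: y)))
  = (fun h : R => h^-1 *: ((u \o shift (x + l *: y)) (h *: (l *: delta_mx ord0 i))
     - u (x + l *: y))).
  apply/funext => h /=; congr (_ *: (u _ - _)).
  by rewrite scalerDr !scalerA (mulrC l) addrCA.
apply: DeriveDef; first by rewrite /derivable /= E.
have <- : 'D_(l *: delta_mx ord0 i) u (x + l *: y) = l * partial i u (x + l *: y).
  rewrite dE (bigD1 i)//= big1 ?addr0 ?mxE ?eqxx ?mulr1// => j ji.
  by rewrite !mxE eqxx/= (negbTE ji) mulr0 mul0r.
by rewrite /derive /= E.
Qed.

Lemma partial_affine u (x : 'rV[R]_n) (l : R) i : smooth u ->
  partial i (fun y => u (x + l *: y)) = fun y => l * partial i u (x + l *: y).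
Proof.
by move=> su; apply/funext => y; have [_] := is_derive_affine x l i y su.
Qed.

Lemma smooth_affine u (x : 'rV[R]_n) (l : R) :
  smooth u -> smooth (fun y => u (x + l *: y)).
Proof.
(* Each derivative brings out a factor [l], so the invariant allows a constant in front. *)
move=> su; apply: (@smooth_coind (fun w => exists2 v, smooth v &
   exists c : R, w = fun y => c * v (x + l *: y))); last first.
  by exists u => //; exists 1; apply/funext => y; rewrite mul1r.
move=> _ [v sv [c ->]]; split.
  have vc : continuous (v \o (fun y => x + l *: y)).
    move=> y; apply: continuous_comp; last exact: smooth_continuous.
    apply: continuousD; first exact: cst_continuous.
    by apply: (@continuousZl_tmp _ _ _ id) => ? ?.
  by move=> y; apply: continuousM; [exact: cst_continuous|exact: vc].
have dv i y : derivable (fun z => v (x + l *: z)) y (delta_mx ord0 i).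
  by have [] := is_derive_affine x l i y sv.
split=> i; first by move=> y; exact: derivableM.
exists (partial i v); first exact: smooth_partial.
exists (c * l).
rewrite (_ : (fun y => _) = cst c \* (fun y => v (x + l *: y)))// partialM//.
rewrite partial_cst partial_affine//.
by apply/funext => y /=; rewrite mul0r add0r mulrA.
Qed.

Lemma smooth_is_derive_curve u (g : R -> 'rV[R]_n) (dg : 'rV[R]_n) (t : R) :
  smooth u -> (forall i, is_derive t 1 (fun s => g s ord0 i) (dg ord0 i)) ->
  is_derive t 1 (u \o g) (\sum_(i < n) dg ord0 i * partial i u (g t)).
Proof.
move=> su; exact: is_derive_curve (smooth_c1 su).1 (smooth_c1 su).2 g dg t.
Qed.

Lemma smooth_partialC u i j : smooth u ->
  partial i (partial j u) = partial j (partial i u).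
Proof.
move=> su; apply: partialC => [{}i y|{}i {}j y|{}i {}j].
- exact: smooth_derivable.
- by apply: smooth_derivable; exact: smooth_partial.
- by apply: smooth_continuous; apply: smooth_partial; exact: smooth_partial.
Qed.

End smooth_closure.

Section smooth_type.
Context (R : realType) (n : nat).

Definition smooth_pred : {pred 'rV[R]_n -> R} := fun u => `[< smooth u >].

Lemma smooth_predP u : reflect (smooth u) (u \in smooth_pred).
Proof. exact: asboolP. Qed.

Lemma smooth_subring_closed : subring_closed smooth_pred.
Proof.
split=> [|u v /smooth_predP su /smooth_predP sv|u v /smooth_predP su /smooth_predP sv];
  apply/smooth_predP.
- exact: (smooth_cst 1).
- have -> : u - v = u \+ (cst (-1) \* v) by apply/funext => y /=; rewrite mulN1r.
  apply: smooth_ring_span; apply: ring_spanD; first exact: ring_span_smooth.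
  by apply: ring_spanM; apply: ring_span_smooth => //; exact: smooth_cst.
- have -> : u * v = u \* v by [].
  exact: (smooth_ring_span (ring_spanM (ring_span_smooth su) (ring_span_smooth sv))).
Qed.

HB.instance Definition _ := GRing.isSubringClosed.Build _ smooth_pred
  smooth_subring_closed.

(** As a subring of all functions this type is a commutative ring, so [ring] proves differential
    identities once the derivatives involved are atoms. *)
Record smoothFun := SmoothFun {
  smooth_val :> 'rV[R]_n -> R ; smooth_valP : smooth_val \in smooth_pred }.

HB.instance Definition _ := [isSub for smooth_val].
HB.instance Definition _ := [Choice of smoothFun by <:].
HB.instance Definition _ := [SubChoice_isSubComNzRing of smoothFun by <:].

End smooth_type.

(** * Euler operator, spherical Laplacian and tangential gradient *)

Section smooth_derivations.
Context {R : realType} {n : nat}.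
Local Notation A := (smoothFun R n).
Implicit Types (f g h : A) (i j : 'I_n).

Lemma smooth_funP f : smooth f.
Proof. exact/smooth_predP/smooth_valP. Qed.

Definition mk_smooth u (su : smooth u) : A := SmoothFun (introT (smooth_predP u) su).

Lemma smooth_eqP f g : (forall y, f y = g y) -> f = g.
Proof. by move=> fg; apply/val_inj/funext. Qed.

Definition sconst (c : R) : A := mk_smooth (smooth_cst c).
Definition scoor i : A := mk_smooth (smooth_coor i).
Definition pd i f : A := mk_smooth (smooth_partial i (smooth_funP f)).
Definition affine (x : 'rV[R]_n) (l : R) f : A :=
  mk_smooth (smooth_affine x l (smooth_funP f)).

Lemma smoothD f g y : (f + g) y = f y + g y. Proof. by []. Qed.
Lemma smoothN f y : (- f) y = - f y. Proof. by []. Qed.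
Lemma smoothM f g y : (f * g) y = f y * g y. Proof. by []. Qed.
Lemma smooth0 y : (0 : A) y = 0. Proof. by []. Qed.
Lemma smooth1 y : (1 : A) y = 1. Proof. by []. Qed.
Lemma smooth_sconst c y : sconst c y = c. Proof. by []. Qed.
Lemma smooth_sum (I : Type) (r : seq I) (F : I -> A) y :
  (\sum_(i <- r) F i) y = \sum_(i <- r) F i y.
Proof. by elim/big_rec2 : _ => // i a b _ <-. Qed.
Lemma smoothMn f k y : (f *+ k) y = f y *+ k.
Proof. by elim: k => // k IH; rewrite !mulrS smoothD IH. Qed.
Lemma smooth_nat k y : (k%:R : A) y = k%:R.
Proof. by rewrite smoothMn smooth1. Qed.
Lemma smoothX f k y : (f ^+ k) y = f y ^+ k.
Proof. by elim: k => // k IH; rewrite !exprS smoothM IH. Qed.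
Definition smoothE := (smoothD, smoothN, smoothM, smooth0, smooth1,
  smooth_nat, smoothX, smoothMn, smooth_sconst).

Lemma sconst_is_zmod_morphism : zmod_morphism (sconst : R -> A).
Proof. by move=> a b; exact: smooth_eqP. Qed.
HB.instance Definition _ := GRing.isZmodMorphism.Build R A sconst sconst_is_zmod_morphism.

Lemma sconst_is_monoid_morphism : monoid_morphism (sconst : R -> A).
Proof.
split; first by apply: smooth_eqP => y; rewrite (smooth_nat 1).
by move=> a b; exact: smooth_eqP.
Qed.
HB.instance Definition _ := GRing.isMonoidMorphism.Build R A sconst sconst_is_monoid_morphism.

Lemma pdE i f y : pd i f y = partial i f y. Proof. by []. Qed.

Lemma pdB i : {morph pd i : f g / f - g}.
Proof.
move=> f g; apply: smooth_eqP => y; rewrite !smoothE !pdE /partial.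
by rewrite deriveB//; apply: smooth_derivable; exact: smooth_funP.
Qed.

HB.instance Definition _ i := GRing.isZmodMorphism.Build A A (pd i) (pdB i).

Lemma pdM i f g : pd i (f * g) = pd i f * g + f * pd i g.
Proof.
have df (h : A) y : derivable h y (delta_mx ord0 i).
  by apply: smooth_derivable; exact: smooth_funP.
apply: smooth_eqP => y; exact: (congr1 (fun w => w y) (partialM (df f) (df g))).
Qed.

Lemma pd_sconst i c : pd i (sconst c) = 0.
Proof. by apply: val_inj; rewrite /= partial_cst. Qed.

Lemma pd_nat i k : pd i (k%:R) = 0.
Proof.
rewrite -(pd_sconst i k%:R); congr (pd i _).
by apply: smooth_eqP => y; rewrite !smoothE.
Qed.

Lemma pd_coor i j : pd i (scoor j) = (j == i)%:R.
Proof.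
by apply: smooth_eqP => y; rewrite smooth_nat pdE partial_coor.
Qed.

Lemma pdC i j f : pd i (pd j f) = pd j (pd i f).
Proof. by apply: val_inj; rewrite /= smooth_partialC//; exact: smooth_funP. Qed.

Lemma pd_affine i x l f : pd i (affine x l f) = sconst l * affine x l (pd i f).
Proof.
by apply: smooth_eqP => y; rewrite pdE/= partial_affine//; exact: smooth_funP.
Qed.

Lemma sum_delta j (F : 'I_n -> A) : \sum_i (i == j)%:R * F i = F j.
Proof.
rewrite (bigD1 j)//= eqxx mul1r big1 ?addr0// => i /negbTE ->.
by rewrite mul0r.
Qed.

Definition euler f : A := \sum_i scoor i * pd i f.
Definition slap f : A := \sum_i pd i (pd i f).
Definition sqnorm : A := \sum_i scoor i * scoor i.
(* On a sphere centered at 0, [sphlap] is r^2 times its Laplace-Beltrami operator.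
   The locks stop rewriting with the rules for [+] and [*] from seeing through
   these definitions. *)
Fact sphlap_key : unit. Proof. exact: tt. Qed.
Definition sphlap : A -> A := locked_with sphlap_key (fun f =>
  sqnorm * slap f - euler (euler f) - (n%:R - 2) * euler f).

Lemma sphlapE f :
  sphlap f = sqnorm * slap f - euler (euler f) - (n%:R - 2) * euler f.
Proof. by rewrite /sphlap unlock. Qed.

Fact sphgrad2_key : unit. Proof. exact: tt. Qed.
Definition sphgrad2 : A -> A -> A := locked_with sphgrad2_key (fun f g =>
  sqnorm * (\sum_i pd i f * pd i g) - euler f * euler g).

Lemma sphgrad2E f g :
  sphgrad2 f g = sqnorm * (\sum_i pd i f * pd i g) - euler f * euler g.
Proof. by rewrite /sphgrad2 unlock. Qed.

Lemma sphgrad2C f g : sphgrad2 f g = sphgrad2 g f.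
Proof.
rewrite !sphgrad2E [euler g * _]mulrC; congr (_ * _ - _).
by apply: eq_bigr => i _; rewrite mulrC.
Qed.

(** Derivative along the infinitesimal rotation in the plane of the axes [i] and [j]. These fields
    are tangent to every sphere centered at 0. *)
Definition angular i j f : A := scoor i * pd j f - scoor j * pd i f.

Lemma eulerB : {morph euler : f g / f - g}.
Proof.
move=> f g; rewrite /euler -sumrB; apply: eq_bigr => i _.
by rewrite raddfB mulrBr.
Qed.

HB.instance Definition _ := GRing.isZmodMorphism.Build A A euler eulerB.

Lemma eulerM f g : euler (f * g) = euler f * g + f * euler g.
Proof.
rewrite /euler mulr_suml mulr_sumr -big_split/=; apply: eq_bigr => i _.
by rewrite pdM; ring.
Qed.

Lemma euler_sconst c : euler (sconst c) = 0.
Proof. by apply: big1 => i _; rewrite pd_sconst mulr0. Qed.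

Lemma euler_nat k : euler k%:R = 0.
Proof. by apply: big1 => i _; rewrite pd_nat mulr0. Qed.

Lemma eulerMn f k : euler (k%:R * f) = k%:R * euler f.
Proof. by rewrite eulerM euler_nat mul0r add0r. Qed.

Lemma slapB : {morph slap : f g / f - g}.
Proof.
by move=> f g; rewrite /slap -sumrB; apply: eq_bigr => i _; rewrite !raddfB.
Qed.

HB.instance Definition _ := GRing.isZmodMorphism.Build A A slap slapB.

Lemma pd_euler i f : pd i (euler f) = pd i f + euler (pd i f).
Proof.
rewrite /euler raddf_sum/=.
under eq_bigr => k _ do rewrite pdM pd_coor (pdC i k).
by rewrite big_split/= (sum_delta i (pd ^~ f)).
Qed.

Lemma slap_euler f : slap (euler f) = euler (slap f) + 2 * slap f.
Proof.
rewrite /slap raddf_sum/= mulr_sumr -big_split/=; apply: eq_bigr => i _.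
by rewrite pd_euler raddfD/= pd_euler; ring.
Qed.

Lemma pd_sqnorm i : pd i sqnorm = 2 * scoor i.
Proof.
rewrite /sqnorm raddf_sum/= -(sum_delta i) mulr_sumr; apply: eq_bigr => k _.
by rewrite pdM pd_coor; ring.
Qed.

Lemma euler_sqnorm : euler sqnorm = 2 * sqnorm.
Proof.
by rewrite /euler mulr_sumr; apply: eq_bigr => i _; rewrite pd_sqnorm; ring.
Qed.

Lemma slap_sqnormM f :
  slap (sqnorm * f) = 2 * n%:R * f + 4 * euler f + sqnorm * slap f.
Proof.
rewrite /slap /euler !mulr_sumr.
rewrite (_ : 2 * n%:R * f = \sum_(i < n) 2 * f); last first.
  by rewrite sumr_const card_ord -[RHS]mulr_natr; ring.
rewrite -!big_split/=; apply: eq_bigr => i _.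
rewrite pdM pd_sqnorm raddfD/= !pdM pd_sqnorm pd_nat pd_coor eqxx /=; ring.
Qed.

Lemma sphlapB : {morph sphlap : f g / f - g}.
Proof. by move=> f g; rewrite !sphlapE !raddfB/=; ring. Qed.

HB.instance Definition _ := GRing.isZmodMorphism.Build A A sphlap sphlapB.

(** [|y|^2 Delta] is homogeneous of degree 0: the 2 gained when E passes [|y|^2] cancels the 2 lost
    when it passes [Delta]. *)
Lemma euler_sphlap f : euler (sphlap f) = sphlap (euler f).
Proof.
rewrite !sphlapE !raddfB/= !eulerM euler_sqnorm slap_euler raddfB/= !euler_nat.
ring.
Qed.

(** The operator acts along spheres centered at 0, on which [sqnorm] is constant. *)
Lemma sphlap_sqnormM f : sphlap (sqnorm * f) = sqnorm * sphlap f.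
Proof.
rewrite !sphlapE slap_sqnormM !eulerM !euler_sqnorm raddfD/= !eulerM euler_sqnorm.
rewrite euler_nat; ring.
Qed.

Lemma sqnorm_slap f :
  sqnorm * slap f = euler (euler f) + (n%:R - 2) * euler f + sphlap f.
Proof. by rewrite sphlapE; ring. Qed.

Lemma angularM i j f g : angular i j (f * g) = angular i j f * g + f * angular i j g.
Proof. by rewrite /angular !pdM; ring. Qed.

Lemma sum_prod (a b : 'I_n -> A) :
  \sum_i \sum_j a i * b j = (\sum_i a i) * (\sum_i b i).
Proof. by rewrite big_distrlr. Qed.

(** Polarized Lagrange identity for the position vector and the two gradients; the factor 2 is there
    because each pair of axes is counted twice. *)
Lemma sum_angular_prod f g :
  \sum_i \sum_j angular i j f * angular i j g = 2 * sphgrad2 f g.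
Proof.
have E i j : angular i j f * angular i j g =
     (scoor i * scoor i) * (pd j f * pd j g) + (pd i f * pd i g) * (scoor j * scoor j)
   - ((scoor i * pd i f) * (scoor j * pd j g) + (scoor i * pd i g) * (scoor j * pd j f)).
  by rewrite /angular; ring.
under eq_bigr => i _ do under eq_bigr => j _ do rewrite E.
under eq_bigr => i _ do rewrite sumrB !big_split/=.
rewrite sumrB !big_split/= !sum_prod sphgrad2E /euler /sqnorm; ring.
Qed.

Lemma euler_hessian f :
  \sum_i \sum_j scoor i * scoor j * pd i (pd j f) = euler (euler f) - euler f.
Proof.
rewrite {1}/euler.
under [in RHS]eq_bigr => i _ do rewrite pd_euler mulrDr.
rewrite big_split/= -[X in _ = X + _ - _]/(euler f) addrAC subrr add0r.
apply: eq_bigr => i _; rewrite /euler mulr_sumr; apply: eq_bigr => j _.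
by rewrite (pdC j i) mulrA.
Qed.

(** Casimir formula: the spherical Laplacian is the sum of the squared rotation fields over
    unordered pairs of axes. *)
Lemma sum_angular2 f : \sum_i \sum_j angular i j (angular i j f) = 2 * sphlap f.
Proof.
pose d i j : A := (i == j)%:R.
have E i j : angular i j (angular i j f) = d i j * (scoor i * pd j f)
    + d j i * (scoor j * pd i f)
    + ((scoor i * scoor i) * pd j (pd j f) + pd i (pd i f) * (scoor j * scoor j))
    - (scoor i * pd i f + scoor j * pd j f)
    - (scoor i * scoor j * pd i (pd j f) + scoor i * scoor j * pd i (pd j f)).
  rewrite /angular !raddfB/= !pdM !pd_coor !eqxx (pdC j i f) /d /=; ring.
under eq_bigr => i _ do under eq_bigr => j _ do rewrite E.
under eq_bigr => i _ do rewrite !sumrB !big_split/=.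
rewrite !sumrB !big_split/= euler_hessian !sum_prod.
have -> : \sum_i \sum_j d j i * (scoor j * pd i f) = euler f.
  by apply: eq_bigr => i _; rewrite (sum_delta i (fun k => scoor k * pd i f)).
have -> : \sum_i \sum_j d i j * (scoor i * pd j f) = euler f.
  rewrite exchange_big; apply: eq_bigr => i _.
  by rewrite (sum_delta i (fun k => scoor k * pd i f)).
have -> : \sum_(i < n) \sum_(j < n) scoor i * pd i f = n%:R * euler f.
  rewrite mulr_sumr; apply: eq_bigr => i _.
  by rewrite sumr_const card_ord mulr_natl.
have -> : \sum_(i < n) \sum_(j < n) scoor j * pd j f = n%:R * euler f.
  by rewrite sumr_const card_ord mulr_natl.
rewrite -/(slap f) -/sqnorm sphlapE; ring.
Qed.

(** Exhibits the integrand of Green's formula as a sum of rotation derivatives, whose spherical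
    means vanish one by one. *)
Lemma sum_angular_green f g :
  \sum_i \sum_j angular i j (f * angular i j g) = 2 * (sphgrad2 f g + f * sphlap g).
Proof.
under eq_bigr => i _ do under eq_bigr => j _ do rewrite angularM.
under eq_bigr => i _ do rewrite big_split/= -mulr_sumr.
rewrite big_split/= -mulr_sumr sum_angular_prod sum_angular2; ring.
Qed.

End smooth_derivations.

(** * Invariance of Lebesgue measure under affine maps and isometries *)

Section lebesgue_affine.
Context {R : realType}.

Definition aff1 (t a : R) (x : measurableTypeR R) : measurableTypeR R := t * x + a.

Lemma measurable_aff1 t a : measurable_fun setT (aff1 t a).
Proof. by apply: measurable_funD => //; exact: measurable_funM. Qed.

Lemma lebesgue_measure_aff1 (t a : R) (A : set (measurableTypeR R)) : 0 < t ->
  measurable A ->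
  (t%:E * @lebesgue_measure R (aff1 t a @^-1` A) = lebesgue_measure A)%E.
Proof.
move=> t0 mA.
have t0' : 0 <= t := ltW t0.
apply/esym.
pose m : {measure set (measurableTypeR R) -> \bar R} :=
  mscale (NngNum t0') (measure_function_pushforward__canonical__measure_function_Measure (@lebesgue_measure R) (measurable_aff1 t a)).
rewrite (lebesgue_measure_unique (mu := m))// => _ [[x y] _ <-].
change (lebesgue_measure `]x, y]%classic = t%:E * @lebesgue_measure R (aff1 t a @^-1` `]x, y]%classic))%E.
rewrite (_ : aff1 t a @^-1` _ = `](x - a) / t, (y - a) / t]%classic); last first.
  apply/seteqP; split=> z /=; rewrite !in_itv/= /aff1;
  by rewrite ltr_pdivrMr// ler_pdivlMr// ltrBlDr lerBrDr (mulrC z).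
rewrite !lebesgue_measure_itv/= !lte_fin ltr_pM2r ?invr_gt0// ltrD2r.
case: ifP => _; last by rewrite mule0.
by rewrite -!EFinB -EFinM; congr (_%:E); field; rewrite gt_eqF.
Qed.

Definition affrV n (t : R) (a y : 'rV[R]_n) : 'rV[R]_n := t *: y + a.

Lemma measurable_affrV n t (a : 'rV[R]_n) : measurable_fun setT (affrV t a).
Proof.
apply: measurable_fun_rVP => i; under eq_fun do rewrite !mxE.
by apply: measurable_funD => //; apply: measurable_funM => //; exact: measurable_coor.
Qed.

Lemma consrV0 n (p : measurableTypeR R * 'rV[R]_n) : consrV p ord0 ord0 = p.1.
Proof. by have := consrVK p => /(congr1 fst). Qed.

Lemma consrV_lift n (p : measurableTypeR R * 'rV[R]_n) j :
  consrV p ord0 (lift ord0 j) = p.2 ord0 j.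
Proof. by have := consrVK p => /(congr1 snd)/rowP/(_ j); rewrite mxE. Qed.

Lemma affrV_cons n t (a : 'rV[R]_n.+1) p :
  affrV t a (consrV p) =
  consrV (aff1 t (unconsrV a).1 p.1, affrV t (unconsrV a).2 p.2).
Proof.
apply/rowP => i; rewrite /affrV mxE [X in X + _]mxE.
have [j ->|->] := unliftP ord0 i.
  by rewrite !consrV_lift !mxE.
by rewrite !consrV0.
Qed.

(** Through [consrV] the affine map is a product of one on the line and one in dimension [n], so the
    scaling holds on rectangles by induction and everywhere by uniqueness of the product measure. *)
Lemma lebesgue_rV_aff n (t : R) (a : 'rV[R]_n) A : 0 < t -> measurable A ->
  ((t ^+ n)%:E * lebesgue_rV n (affrV t a @^-1` A) = lebesgue_rV n A)%E.
Proof.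
move=> t0; elim: n a A => [|n IH] a A mA.
  rewrite mul1e; congr (lebesgue_rV 0 _); apply/seteqP.
  by split=> y /=; rewrite (thinmx0 (affrV t a y)) (thinmx0 y).
pose a1 := (unconsrV a).1; pose a2 := (unconsrV a).2.
pose psi (p : measurableTypeR R * 'rV[R]_n) : measurableTypeR R * 'rV[R]_n :=
  (aff1 t a1 p.1, affrV t a2 p.2).
have mpsi : measurable_fun setT psi.
  apply: measurable_fun_pair; apply: measurableT_comp => //.
    exact: measurable_aff1.
  exact: measurable_affrV.
have tn0 k : 0 <= t ^+ k by exact/ltW/exprn_gt0.
pose m := (@lebesgue_measure R \x lebesgue_rV n)%E.
pose m' : {measure set (measurableTypeR R * 'rV[R]_n) -> \bar R} :=
  mscale (NngNum (tn0 n.+1)) (measure_function_pushforward__canonical__measure_function_Measure m mpsi).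
have mm' X : measurable X -> (m X = (t ^+ n.+1)%:E * m (psi @^-1` X))%E.
  apply: (@product_measure_unique _ _ _ _ _ _ _ m') => B C mB mC.
  transitivity ((t ^+ n.+1)%:E * m (psi @^-1` (B `*` C)))%E; first by [].
  have -> : psi @^-1` (B `*` C) = (aff1 t a1 @^-1` B) `*` (affrV t a2 @^-1` C) by [].
  have mB' : measurable (aff1 t a1 @^-1` B).
    by rewrite -[X in measurable X]setTI; exact: measurable_aff1.
  have mC' : measurable (affrV t a2 @^-1` C).
    by rewrite -[X in measurable X]setTI; exact: measurable_affrV.
  have E D F : measurable D -> measurable F ->
      m (D `*` F) = (@lebesgue_measure R D * lebesgue_rV n F)%E.
    by move=> mD mF; rewrite /m product_measure1E.
  rewrite !E// exprS EFinM muleACA; congr (_ * _)%E.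
    exact: lebesgue_measure_aff1.
  exact: IH.
have mcA : measurable (@consrV R n @^-1` A).
  by rewrite -[X in measurable X]setTI; exact: measurable_consrV.
rewrite -[RHS]/(m (@consrV R n @^-1` A)) mm'//; congr (_ * m _)%E.
by apply/seteqP; split=> p /=; rewrite affrV_cons.
Qed.

End lebesgue_affine.

Section lebesgue_box.
Context {R : realType}.

Definition box n (r : R) : set 'rV[R]_n := [set y | forall i, - r < y ord0 i < r].
Arguments box : clear implicits.

Lemma measurable_box n r : measurable (box n r).
Proof.
rewrite (_ : box n r = \bigcap_(i in [set: 'I_n])
    ((fun y : 'rV[R]_n => y ord0 i : measurableTypeR R) @^-1` `]-r, r[%classic)).
  apply: fin_bigcap_measurable; first exact: finite_finset.
  move=> i _; rewrite -[X in measurable X]setTI.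
  by apply: measurable_coor => //; exact: measurable_itv.
by apply/seteqP; split=> y yr i; [move=> _|]; have := yr i; rewrite /= in_itv//=; apply.
Qed.

Lemma lebesgue_box n r : 0 < r -> lebesgue_rV n (box n r) = ((r *+ 2) ^+ n)%:E.
Proof.
move=> r0; elim: n => [|n IH].
  by rewrite /= diracE mem_set// => -[].
rewrite [LHS](_ : _ = (@lebesgue_measure R \x lebesgue_rV n)%E
    (`]-r, r[%classic `*` box n r)); last first.
  rewrite /= /lebesgue_rV_step /pushforward; congr (_ _).
  apply/seteqP; split=> -[x y] /=.
    move=> xy; split; first by have := xy ord0; rewrite consrV0 in_itv.
    by move=> i; have := xy (lift ord0 i); rewrite consrV_lift.
  rewrite in_itv => -[xr yr] i; have [j ->|->] := unliftP ord0 i.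
    by rewrite consrV_lift.
  by rewrite consrV0.
rewrite product_measure1E//; last exact: measurable_box.
rewrite exprS EFinM; congr (_ * _)%E; last exact: IH.
rewrite -[LHS]/(@lebesgue_measure R `]-r, r[%classic) lebesgue_measure_itv/=.
by rewrite lte_fin gtrN// -EFinD opprK mulr2n.
Qed.

Lemma enorm_ge0 n (y : 'rV[R]_n) : 0 <= enorm y.
Proof. exact: sqrtr_ge0. Qed.

Lemma enorm_sqr n (y : 'rV[R]_n) : enorm y ^+ 2 = edot y y.
Proof. by rewrite sqr_sqrtr// edot_ge0. Qed.

Lemma coor_enorm n (y : 'rV[R]_n) i : `|y ord0 i| <= enorm y.
Proof.
rewrite -(ler_pXn2r (n := 2))// ?nnegrE ?enorm_ge0// enorm_sqr real_normK ?num_real//.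
rewrite /edot (bigD1 i)//= -expr2 lerDl; apply: sumr_ge0 => j _.
by rewrite -expr2 sqr_ge0.
Qed.

Lemma eball_sub_box n r : eball 0 r `<=` box n r.
Proof.
by move=> y; rewrite /eball/= subr0 => yr i; rewrite -ltr_norml (le_lt_trans _ yr)// coor_enorm.
Qed.

Lemma box_sub_eball n : box n (n.+1%:R^-1) `<=` @eball R n 0 1.
Proof.
move=> y yr; rewrite /eball/= subr0.
rewrite -(ltr_pXn2r (n := 2))// ?nnegrE ?enorm_ge0// enorm_sqr expr1n /edot.
apply: (@le_lt_trans _ _ (\sum_(i < n) n.+1%:R^-1)).
  apply: ler_sum => i _; rewrite -expr2 -real_normK ?num_real//.
  have := yr i; rewrite -ltr_norml => yi.
  rewrite (le_trans (_ : _ <= `|y ord0 i|))//; last exact: ltW.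
  rewrite expr2 ler_piMl// (le_trans (ltW yi))// invf_le1//.
  by rewrite ler1n.
by rewrite sumr_const card_ord -[ltLHS]mulr_natl ltr_pdivrMr// mul1r ltr_nat.
Qed.

Lemma lebesgue_eball_lty n r : (@lebesgue_rV R n (eball 0 r) < +oo)%E.
Proof.
have r0 : 0 < `|r| + 1 by rewrite ltr_wpDl.
apply: (@le_lt_trans _ _ (lebesgue_rV n (box n (`|r| + 1)))); last first.
  by rewrite lebesgue_box// ltry.
apply: le_measure; rewrite ?inE; [exact: measurable_eball|exact: measurable_box|].
apply: subset_trans (@eball_sub_box n _); rewrite /eball => y /= yr.
by rewrite (lt_le_trans yr)// (le_trans (ler_norm r))// lerDl.
Qed.

Lemma lebesgue_eball1_gt0 n : (0 < @lebesgue_rV R n (eball 0 1))%E.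
Proof.
apply: (@lt_le_trans _ _ (lebesgue_rV n (box n (n.+1%:R^-1)))).
  by rewrite lebesgue_box// lte_fin exprn_gt0// pmulrn_rgt0.
apply: le_measure; rewrite ?inE; [exact: measurable_box|exact: measurable_eball|].
exact: box_sub_eball.
Qed.

End lebesgue_box.

(** * Translation-invariant measures and isometries *)

Section translation_invariant.
Context {R : realType} {n : nat}.
Implicit Types (m : {sigma_finite_measure set 'rV[R]_n -> \bar R}) (A B : set 'rV[R]_n).
Local Open Scope ereal_scope.

Definition translation_invariant (m : set 'rV[R]_n -> \bar R) := forall v A,
  measurable A -> m [set y | A (y + v)%R] = m A.

Lemma tonelli_sections m1 m2 (S : set ('rV[R]_n * 'rV[R]_n)) : measurable S ->
  \int[m1]_x m2 [set y | S (x, y)] = \int[m2]_y m1 [set x | S (x, y)].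
Proof.
move=> mS; have := indic_fubini_tonelli m1 m2 mS.
rewrite indic_fubini_tonelli_FE// indic_fubini_tonelli_GE//=.
under eq_integral do rewrite xsectionE.
by under [X in _ = X -> _]eq_integral do rewrite ysectionE.
Qed.

Lemma integral_slice m (c : \bar R) B (f : 'rV[R]_n -> \bar R) : measurable B ->
  (forall y, B y -> f y = c) -> (forall y, ~ B y -> f y = 0) ->
  \int[m]_y f y = c * m B.
Proof.
move=> mB fc f0; rewrite -integral_cst// [RHS]integral_mkcond.
apply: eq_integral => y _; rewrite patchE; case: ifPn; rewrite ?inE ?notin_setE.
  exact: fc.
exact: f0.
Qed.

(* Both sides are the product measure of [{(x, y) | A (x + y), B y}]. *)
Lemma translation_invariant_unique m1 m2 A B :
  translation_invariant m1 -> translation_invariant m2 ->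
  measurable A -> measurable B -> (forall y, B y <-> B (- y)%R) ->
  m1 A * m2 B = m2 A * m1 B.
Proof.
move=> m1T m2T mA mB symB.
pose S1 := [set p : 'rV[R]_n * 'rV[R]_n | A (p.1 + p.2)%R /\ B p.2].
pose S2 := [set p : 'rV[R]_n * 'rV[R]_n | A p.2 /\ B (p.2 - p.1)%R].
have madd : measurable_fun setT (fun p : 'rV[R]_n * 'rV[R]_n => p.1 + p.2)%R.
  apply: measurable_fun_rVP => i; under eq_fun do rewrite mxE.
  by apply: measurable_funD; exact: measurableT_comp (measurable_coor i) _.
have msub : measurable_fun setT (fun p : 'rV[R]_n * 'rV[R]_n => p.2 - p.1)%R.
  apply: measurable_fun_rVP => i; under eq_fun do rewrite !mxE.
  by apply: measurable_funB; exact: measurableT_comp (measurable_coor i) _.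
have mpre (f : 'rV[R]_n * 'rV[R]_n -> 'rV[R]_n) C : measurable_fun setT f ->
    measurable C -> measurable (f @^-1` C).
  by move=> mf mC; rewrite -[X in measurable X]setTI; exact: mf.
have mS1 : measurable S1.
  by apply: measurableI; [exact: (mpre _ _ madd)|exact: (mpre _ _ measurable_snd)].
have mS2 : measurable S2.
  by apply: measurableI; [exact: (mpre _ _ measurable_snd)|exact: (mpre _ _ msub)].
transitivity (\int[m2]_y m1 [set x | S1 (x, y)]).
  apply/esym; apply: integral_slice => // y By.
    rewrite -[RHS](m1T y)//; congr (m1 _).
    by apply/seteqP; split=> x /=; [case|].
  by rewrite -[RHS](measure0 m1); congr (m1 _); apply/seteqP; split=> x //= [].
rewrite -tonelli_sections//.
(* For fixed [x] the sections of [S1] and [S2] are translates of each other by [x]. Tonelli then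
   exposes the sections of [S2] at fixed [y], which are translates of [B] reflected through 0; this
   is where the symmetry of [B] enters. *)
transitivity (\int[m1]_x m2 [set y | S2 (x, y)]).
  apply: eq_integral => x _.
  rewrite -[RHS](m2T x)//.
    congr (m2 _); apply/seteqP; split=> y; rewrite /S1 /S2/= addrK addrC//.
  have := measurable_xsection x mS2; rewrite xsectionE; exact.
rewrite tonelli_sections// muleC.
apply: integral_slice => // y Ay; last first.
  by rewrite -[RHS](measure0 m1); congr (m1 _); apply/seteqP; split=> x //= [].
rewrite -[RHS](m1T (- y)%R)//; congr (m1 _).
apply/seteqP; split=> x; rewrite /S2/=.
  by move=> [_ /symB]; rewrite opprB.
by move=> Bxy; split=> //; apply/symB; rewrite opprB.
Qed.

End translation_invariant.

Section isometry.
Context {R : realType} {n : nat}.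

Lemma lebesgue_rV_translation : translation_invariant (@lebesgue_rV R n).
Proof.
move=> v A mA; rewrite -[RHS](@lebesgue_rV_aff _ _ 1 v)// expr1n mul1e.
by congr (lebesgue_rV n _); apply/seteqP; split=> y /=; rewrite /affrV scale1r.
Qed.

Variable O : 'rV[R]_n -> 'rV[R]_n.
Hypothesis mO : measurable_fun setT O.
Hypothesis O_D : {morph O : x y / x + y}.
Hypothesis O_surj : forall v, exists w, O w = v.
Hypothesis O_norm : forall y, enorm (O y) = enorm y.

Definition iso_measure : set 'rV[R]_n -> \bar R := pushforward (lebesgue_rV n) O.

Let iso0 : iso_measure set0 = 0%E.
Proof. by rewrite /iso_measure /pushforward preimage_set0 measure0. Qed.

Let iso_ge0 A : (0 <= iso_measure A)%E.
Proof. exact: measure_ge0. Qed.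

Let iso_sigma_additive : semi_sigma_additive iso_measure.
Proof.
exact: (@measure_semi_sigma_additive _ _ _
 (measure_function_pushforward__canonical__measure_function_Measure (lebesgue_rV n) mO)).
Qed.

HB.instance Definition _ := isMeasure.Build _ _ _ iso_measure
  iso0 iso_ge0 iso_sigma_additive.

Let iso_eball r : O @^-1` eball 0 r = eball 0 r.
Proof. by apply/seteqP; split=> y; rewrite /eball /= !subr0 O_norm. Qed.

Let iso_sigma_finite : sigma_finite setT iso_measure.
Proof.
exists (fun k => eball 0 k%:R).
  apply/esym; rewrite -subTset => y _; exists (Num.truncn (enorm y)).+1 => //.
  by rewrite /eball/= subr0 truncnS_gt.
move=> k; split; first exact: measurable_eball.
by rewrite /iso_measure /pushforward iso_eball lebesgue_eball_lty.
Qed.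

HB.instance Definition _ := Measure_isSigmaFinite.Build _ _ _ iso_measure
  iso_sigma_finite.

(** Since [O] is additive and onto, the pushforward is again translation invariant, hence
    proportional to Lebesgue measure. The factor is 1 because [O] preserves the unit ball, whose
    volume is positive and finite. No determinant enters. *)
Lemma lebesgue_rV_isometry A : measurable A ->
  lebesgue_rV n (O @^-1` A) = lebesgue_rV n A.
Proof.
move=> mA; have isoT : translation_invariant iso_measure.
  move=> v B mB; have [w <-] := O_surj v.
  rewrite /iso_measure /pushforward -[RHS](lebesgue_rV_translation w).
    by congr (lebesgue_rV n _); apply/seteqP; split=> y /=; rewrite O_D.
  by rewrite -[X in measurable X]setTI; exact: mO.
have symB y : @eball R n 0 1 y <-> eball 0 1 (- y).
  rewrite /eball /= !subr0 (_ : enorm (- y) = enorm y)//.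
  by congr (Num.sqrt _); apply: eq_bigr => i _; rewrite !mxE mulrNN.
have := translation_invariant_unique isoT lebesgue_rV_translation mA
  (measurable_eball 0 1) symB.
rewrite -[X in _ = (_ * X)%E -> _]/(lebesgue_rV n (O @^-1` eball 0 1)) iso_eball.
have b0 := @lebesgue_eball1_gt0 R n; have boo := @lebesgue_eball_lty R n 1.
set b := lebesgue_rV n (eball 0 1) in b0 boo *.
have bfin : b \is a fin_num by rewrite ge0_fin_numE// ltW.
have b1 : (b * (fine b)^-1%:E = 1)%E.
  by rewrite -[X in (X * _)%E](fineK bfin) -EFinM divff// gt_eqF// fine_gt0// b0.
by move=> /(congr1 (fun z => z * (fine b)^-1%:E)%E); rewrite -!muleA b1 !mule1.
Qed.

End isometry.

(** * Borel measurability of continuous functions *)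

Section continuous_measurable.
Context {R : realType} {n : nat}.

(** The sigma-algebra is generated by the coordinates, so open sets have to be recovered: each is
    the countable union of the rational cubes that it contains. *)
Lemma continuous_measurable_rV (f : 'rV[R]_n -> R) : continuous f ->
  measurable_fun setT (f : 'rV[R]_n -> measurableTypeR R).
Proof.
move=> cf; apply: (measurability _ (RGenOInfty.measurableE R)).
move=> /= _ [_ [a ->]] <-; rewrite setTI.
have Uo : open (f @^-1` `]a, +oo[%classic).
  by apply: open_comp; [move=> x _; exact: cf|exact: interval_open].
set U := f @^-1` _ in Uo *.
pose cube (p : 'rV[rat]_n * nat) : set 'rV[R]_n :=
  [set y | forall i, `|y ord0 i - ratr (p.1 ord0 i)| < p.2.+1%:R^-1].
pose F p := if `[< cube p `<=` U >] then cube p else set0.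
rewrite (_ : U = \bigcup_(p in setT) F p).
  apply: countable_bigcupT_measurable => // p; rewrite /F; case: ifP => // _.
  rewrite (_ : cube p = \bigcap_(i in [set: 'I_n])
      ((fun y : 'rV[R]_n => y ord0 i : measurableTypeR R) @^-1`
        (ball (ratr (p.1 ord0 i) : R) (p.2.+1%:R^-1)))).
    apply: fin_bigcap_measurable; first exact: finite_finset.
    move=> i _; rewrite -[X in measurable X]setTI.
    by apply: measurable_coor => //; exact: measurable_ball.
  apply/seteqP; split=> y yp i; [move=> _|]; have := yp i;
    by rewrite /= -ball_normE/= distrC//; apply.
apply/seteqP; split=> [y Uy|y [p _]]; last first.
  by rewrite /F; case: ifPn => // /asboolP pU /pU.
have /nbhs_ballP[e /= e0 yU] : nbhs y U by exact: open_nbhs_nbhs.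
have e20 : 0 < e / 2 by rewrite divr_gt0.
pose k := Num.truncn ((e / 2)^-1).
have ke : k.+1%:R^-1 < e / 2.
  by rewrite invf_plt ?posrE// truncnS_gt.
have k0 : 0 < k.+1%:R^-1 :> R by rewrite invr_gt0.
have /choice[c cP] : forall i, exists c : rat, `|y ord0 i - ratr c| < k.+1%:R^-1.
  move=> i; have lt2 : y ord0 i - k.+1%:R^-1 < y ord0 i + k.+1%:R^-1.
    by rewrite ltrD2l gtrN.
  have [c] := rat_in_itvoo lt2; rewrite in_itv/= => /andP[c1 c2]; exists c.
  by rewrite distrC ltr_distl c1 c2.
have pk : cube (\row_i c i, k) `<=` U.
  move=> z zk; apply: yU; rewrite -ball_normE/=.
  apply: (@le_lt_trans _ _ (k.+1%:R^-1 + k.+1%:R^-1)).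
    apply: row_norm_le => [|i]; first by rewrite addr_ge0// ltW.
    rewrite !mxE; have := zk i; rewrite mxE/= => /ltW zi.
    have /ltW yi := cP i; apply: le_trans (lerD yi zi).
    by rewrite [X in _ <= _ + X]distrC -[X in `|X| <= _](subrKA (ratr (c i))) ler_normD.
  by rewrite (splitr e) ltrD.
exists (\row_i c i, k) => //; rewrite /F; case: ifPn => [_|/asboolP//] i.
by rewrite mxE; exact: cP.
Qed.

End continuous_measurable.

(** * Spherical means *)

Section transfer.
Context d d' {X : measurableType d} {Y : measurableType d'} {R : realType}.
Variables (mu : {measure set X -> \bar R}) (nu : {measure set Y -> \bar R}).

(** The measures are compared on subsets of [D] only: the map used for the sphere sends everything
    outside the unit ball to 0, so sets containing 0 may break the identity. *)
Lemma Rintegral_transfer (D : set Y) (T : X -> Y) (k : {nonneg R}) (f : Y -> R) :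
  measurable D -> measurable_fun setT T ->
  measurable_fun setT (f : Y -> measurableTypeR R) ->
  (forall A, measurable A -> A `<=` D -> nu A = (k%:num%:E * mu (T @^-1` A))%E) ->
  mu.-integrable (T @^-1` D) (EFin \o (f \o T)) ->
  \int[nu]_(y in D) f y = k%:num * \int[mu]_(x in T @^-1` D) f (T x).
Proof.
move=> mD mT mf nuE fTint.
pose mu1 := measure_function_pushforward__canonical__measure_function_Measure mu mT.
have fint1 : mu1.-integrable D (EFin \o f).
  by apply: integrable_pushforward => //; exact/measurable_EFinP.
rewrite /Rintegral (eq_measure_integral (mscale k mu1)); last exact: nuE.
have E : (\int[mscale k mu1]_(y in D) (f y)%:E =
   k%:num%:E * \int[mu1]_(y in D) (f y)%:E)%E.
  have mf' : measurable_fun D (EFin \o f).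
    by apply/measurable_EFinP; exact: measurable_funTS.
  (* The scaling rule is applied to the nonnegative positive and negative parts; integrability of
     [f] makes their difference meaningful. *)
  have Ep := ge0_integral_mscale mu1 mD k (measurable_funepos mf')
    (fun x _ => funepos_ge0 (EFin \o f) x).
  have En := ge0_integral_mscale mu1 mD k (measurable_funeneg mf')
    (fun x _ => funeneg_ge0 (EFin \o f) x).
  have kfin : (k%:num : R)%:E \is a fin_num by [].
  rewrite [LHS]integralE [in RHS]integralE.
  by rewrite (muleBr kfin (integrable_add_def mD fint1)) -Ep -En.
rewrite E (fineM _ (integrable_fin_num mD fint1))//; congr (_ * fine _).
by rewrite (integral_pushforward mT _ _ mD)//; exact/measurable_EFinP.
Qed.

End transfer.

Section punctured_ball.
Context {R : realType} {n : nat}.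
Implicit Types (y z : 'rV[R]_n) (f g : 'rV[R]_n -> R).
Local Notation leb := (@lebesgue_rV R n).

(** The center is removed because [udir] takes the default value 0 there; elsewhere [udir] lands on
    the unit sphere. *)
Definition dball (r : R) : set 'rV[R]_n := [set z | 0 < enorm z < r].

Lemma enormZ (a : R) y : enorm (a *: y) = `|a| * enorm y.
Proof.
rewrite /enorm (_ : edot (a *: y) (a *: y) = a ^+ 2 * edot y y).
  by rewrite sqrtrM ?sqr_ge0// sqrtr_sqr.
rewrite /edot mulr_sumr; apply: eq_bigr => i _; rewrite !mxE; ring.
Qed.

Lemma enorm0 : enorm (0 : 'rV[R]_n) = 0.
Proof. by rewrite -(scale0r (0 : 'rV[R]_n)) enormZ normr0 mul0r. Qed.

Lemma enorm_udir z : 0 < enorm z -> enorm (udir z) = 1.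
Proof.
move=> z0; rewrite /udir enormZ normrV ?unitfE ?gt_eqF// ger0_norm ?ltW//.
by rewrite mulVf// gt_eqF.
Qed.

Lemma udirK z : 0 < enorm z -> z = enorm z *: udir z.
Proof. by move=> z0; rewrite /udir scalerA divff ?scale1r// gt_eqF. Qed.

Lemma udirZ (a : R) z : 0 < a -> udir (a *: z) = udir z.
Proof.
move=> a0; rewrite /udir enormZ scalerA invfM ger0_norm ?ltW//.
by rewrite mulrAC mulVf ?mul1r// gt_eqF.
Qed.

Lemma measurable_dball r : measurable (dball r).
Proof.
rewrite (_ : dball r = (fun y : 'rV[R]_n => enorm (y - 0)) @^-1` `]0, r[%classic).
  rewrite -[X in measurable X]setTI.
  by apply: measurable_enorm => //; exact: measurable_itv.
by apply/seteqP; split=> y /=; rewrite in_itv/= subr0.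
Qed.

Lemma lebesgue_dball_lty r : (leb (dball r) < +oo)%E.
Proof.
apply: le_lt_trans (lebesgue_eball_lty n r); apply: le_measure; rewrite ?inE.
- exact: measurable_dball.
- exact: measurable_eball.
- by move=> y /= /andP[]; rewrite /eball/= subr0.
Qed.

Lemma continuous_ball_bounded f (r : R) : continuous f ->
  exists2 M : R, 0 <= M & forall y, enorm y <= r -> `|f y| <= M.
Proof.
move=> cf.
have : compact [set v : 'rV[R]_n | forall i, v ord0 i \in `[- r, r]].
  apply: (@rV_compact _ _ (fun=> `[- r, r]%classic)) => _; exact: segment_compact.
move=> /(continuous_compact (continuous_subspaceT cf))/compact_bounded[M [_ Mf]].
exists (`|M| + 1); first by rewrite addr_ge0.
move=> y yr; apply: (Mf (`|M| + 1)); first by rewrite (le_lt_trans (ler_norm M))// ltrDl.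
by exists y => // i; rewrite in_itv/= -ler_norml (le_trans (coor_enorm y i)).
Qed.

Lemma integrable_dball f (phi : 'rV[R]_n -> 'rV[R]_n) (D : set 'rV[R]_n) (r : R) :
  measurable D -> (leb D < +oo)%E ->
  continuous f -> measurable_fun setT phi -> (forall z, D z -> enorm (phi z) <= r) ->
  leb.-integrable D (EFin \o (f \o phi)).
Proof.
move=> mD Doo cf mphi phir; apply: measurable_bounded_integrable => //.
  apply: measurable_funTS; apply: measurableT_comp => //.
  exact: continuous_measurable_rV.
have [M M0 fM] := continuous_ball_bounded r cf.
exists M; split; first exact: num_real.
by move=> x Mx z Dz; rewrite /= (le_trans (fM _ (phir _ Dz)))// ltW.
Qed.

Lemma sphere_integral f : continuous f ->
  \int[@sphere_measure R n]_(y in esphere 0 1) f y =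
  n%:R * \int[leb]_(z in dball 1) f (udir z).
Proof.
move=> cf.
(* Cutting [udir] off outside the ball gives a measurable map on the whole space under which the
   preimage of the sphere is exactly the punctured ball, since 0 is not on the sphere. *)
pose T z : 'rV[R]_n := \1_(eball 0 1) z *: udir z.
have TE z : eball 0 1 z -> T z = udir z.
  by move=> zB; rewrite /T indicE mem_set// scale1r.
have T0 z : ~ eball 0 1 z -> T z = 0.
  by move=> zB; rewrite /T indicE memNset// scale0r.
have mT : measurable_fun setT T.
  apply: measurable_fun_rVP => i; under eq_fun do rewrite mxE.
  apply: measurable_funM; first by apply: measurable_indic; exact: measurable_eball.
  exact: measurableT_comp (measurable_coor i) (@measurable_udir R n).
have S_n0 : ~ esphere 0 1 (0 : 'rV[R]_n).
  by rewrite /esphere/= subr0 enorm0 => /eqP; rewrite eq_sym oner_eq0.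
have mS : measurable (esphere (0 : 'rV[R]_n) 1).
  rewrite (_ : esphere 0 1 = (fun y : 'rV[R]_n => enorm (y - 0)) @^-1` [set 1])//.
  by rewrite -[X in measurable X]setTI; apply: measurable_enorm => //; exact: measurable_set1.
have n0 : 0 <= n%:R :> R by [].
have TS : T @^-1` esphere 0 1 = dball 1.
  apply/seteqP; split=> z; rewrite /dball/=.
    have [zB|zB] := pselect (eball 0 1 z); last by rewrite T0.
    rewrite TE//; move: zB; rewrite /eball/= subr0 => -> zS; rewrite andbT.
    rewrite lt_neqAle enorm_ge0 andbT eq_sym; apply/eqP => z0.
    by move: zS; rewrite /udir z0 invr0 scale0r => /S_n0.
  move=> /andP[z0 z1]; rewrite TE; last by rewrite /eball/= subr0.
  by rewrite /esphere/= subr0 enorm_udir.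
have TEd z : dball 1 z -> T z = udir z.
  by move=> /andP[_ z1]; rewrite TE// /eball/= subr0.
have mf := continuous_measurable_rV cf.
have fint : leb.-integrable (dball 1) (EFin \o (f \o @udir R n)).
  apply: (@integrable_dball _ _ _ 1) => //.
  - exact: measurable_dball.
  - exact: lebesgue_dball_lty.
  - exact: measurable_udir.
  - by move=> z /andP[z0 _]; rewrite enorm_udir.
rewrite (@Rintegral_transfer _ _ _ _ R leb _ _ T (NngNum n0) f mS mT mf) ?TS/=.
- by congr (_ * _); apply: eq_Rintegral => z; rewrite inE => /TEd ->.
- move=> A mA AS; rewrite /sphere_measure; congr (_ * leb _)%E.
  apply/seteqP; split=> z /=; first by move=> [zB]; rewrite TE.
  have [zB|zB] := pselect (eball 0 1 z); first by rewrite TE.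
  by rewrite T0// => /AS.
- apply: eq_integrable fint; first exact: measurable_dball.
  by move=> z; rewrite inE => /TEd zE /=; rewrite zE.
Qed.

Lemma Rintegral_isometry f (O : 'rV[R]_n -> 'rV[R]_n) :
  continuous f -> measurable_fun setT O -> {morph O : x y / x + y} ->
  (forall v, exists w, O w = v) -> (forall y, enorm (O y) = enorm y) ->
  \int[leb]_(z in dball 1) f (udir (O z)) = \int[leb]_(z in dball 1) f (udir z).
Proof.
move=> cf mO OD Os On.
have OB : O @^-1` dball 1 = dball 1 by apply/seteqP; split=> z; rewrite /dball/= On.
have mf : measurable_fun setT (EFin \o (f \o @udir R n)).
  apply/measurable_EFinP; apply: measurableT_comp; last exact: measurable_udir.
  exact: continuous_measurable_rV.
rewrite /Rintegral; congr fine; apply/esym.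
rewrite (eq_measure_integral
  (measure_function_pushforward__canonical__measure_function_Measure leb mO)); last first.
  by move=> A mA _; apply/esym; exact: lebesgue_rV_isometry.
rewrite (integral_pushforward mO mf) ?OB//; last exact: measurable_dball.
apply: (@integrable_dball _ (@udir R n \o O) _ 1) => //.
- exact: measurable_dball.
- exact: lebesgue_dball_lty.
- by apply: measurableT_comp => //; exact: measurable_udir.
- by move=> z /andP[z0 _]; rewrite /= enorm_udir// On.
Qed.

End punctured_ball.

Section spherical_mean.
Context {R : realType} {n : nat}.
Local Notation A := (smoothFun R n).
Local Notation leb := (@lebesgue_rV R n).
Implicit Types (y z : 'rV[R]_n) (f g : A) (l : R).

Definition smean f l : R := n%:R * \int[leb]_(z in dball 1) f (l *: udir z).

Lemma smooth_fun_continuous f : continuous f.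
Proof. exact/smooth_continuous/smooth_funP. Qed.

Lemma affine0E f l y : affine 0 l f y = f (l *: y).
Proof. by rewrite /= add0r. Qed.

Lemma sphere_smean f l :
  \int[@sphere_measure R n]_(y in esphere 0 1) f (l *: y) = smean f l.
Proof.
rewrite /smean (_ : (fun y => f (l *: y)) = affine 0 l f); last first.
  by apply/funext => y; rewrite affine0E.
rewrite (sphere_integral (@smooth_fun_continuous (affine 0 l f))).
by congr (_ * _); apply: eq_Rintegral => z _; rewrite affine0E.
Qed.

Lemma measurable_scaled_udir l : measurable_fun setT (fun z : 'rV[R]_n => l *: udir z).
Proof.
apply: measurable_fun_rVP => i; under eq_fun do rewrite mxE.
apply: measurable_funM => //.
exact: measurableT_comp (measurable_coor i) (@measurable_udir R n).
Qed.

Lemma enorm_scaled_udir l z : dball 1 z -> enorm (l *: udir z) = `|l|.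
Proof. by move=> /andP[z0 _]; rewrite enormZ enorm_udir// mulr1. Qed.

Lemma integrable_smean f l :
  leb.-integrable (dball 1) (EFin \o (fun z => f (l *: udir z))).
Proof.
apply: (@integrable_dball _ _ f (fun z => l *: udir z) (dball 1) `|l|).
- exact: measurable_dball.
- exact: lebesgue_dball_lty.
- exact: smooth_fun_continuous.
- exact: measurable_scaled_udir.
- by move=> z z1; rewrite enorm_scaled_udir.
Qed.

Lemma smeanB f g l : smean (f - g) l = smean f l - smean g l.
Proof.
by rewrite /smean -mulrBr
  -(RintegralB (measurable_dball 1) (integrable_smean f l) (integrable_smean g l)).
Qed.

Lemma smean0 l : smean 0 l = 0.
Proof. by rewrite -(subrr (0 : A)) smeanB subrr. Qed.

Lemma smeanN f l : smean (- f) l = - smean f l.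
Proof. by rewrite -sub0r smeanB smean0 sub0r. Qed.

Lemma smeanD f g l : smean (f + g) l = smean f l + smean g l.
Proof. by rewrite -{1}[g]opprK smeanB smeanN opprK. Qed.

Lemma smeanZ c f l : smean (sconst c * f) l = c * smean f l.
Proof.
by rewrite /smean mulrCA -(RintegralZl c (measurable_dball 1) (integrable_smean f l)).
Qed.

Lemma smean_sum (I : Type) (r : seq I) (F : I -> A) l :
  smean (\sum_(i <- r) F i) l = \sum_(i <- r) smean (F i) l.
Proof.
elim: r => [|i r IH]; first by rewrite !big_nil smean0.
by rewrite !big_cons smeanD IH.
Qed.

Lemma smean_ge0 f l : (forall y, enorm y = 1 -> 0 <= f (l *: y)) -> 0 <= smean f l.
Proof.
move=> f0; rewrite /smean mulr_ge0//; apply: Rintegral_ge0 => z /andP[z0 _].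
by apply: f0; rewrite enorm_udir.
Qed.

Lemma le_smean f g l : (forall y, enorm y = 1 -> f (l *: y) <= g (l *: y)) ->
  smean f l <= smean g l.
Proof.
move=> fg; rewrite -subr_ge0 -smeanB; apply: smean_ge0 => y y1.
by rewrite !smoothE subr_ge0 fg.
Qed.

Lemma smean_bounded f (r : R) :
  exists2 M : R, 0 <= M & forall l, `|l| <= r -> `|smean f l| <= M.
Proof.
have [M M0 fM] := continuous_ball_bounded r (smooth_fun_continuous (f := f)).
exists (n%:R * (M * fine (leb (dball 1)))).
  have c0 : 0 <= fine (leb (dball 1)) by exact/fine_ge0/measure_ge0.
  by apply: mulr_ge0 => //; exact: mulr_ge0.
move=> l lr; rewrite /smean normrM normr_nat ler_wpM2l//.
have md : measurable (dball 1 : set 'rV[R]_n) := measurable_dball 1.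
have fi := integrable_smean f l.
apply: (le_trans (le_normr_Rintegral md fi)).
rewrite -(Rintegral_cst leb md M); apply: le_Rintegral => //.
- exact: integrable_norm.
- apply: (@measurable_bounded_integrable _ _ _ _ (cst M)) => //; last exact: bounded_cst.
  exact: lebesgue_dball_lty.
- move=> z z1; apply: fM; rewrite enorm_scaled_udir//.
Qed.

Lemma is_derive_radial f (t : R) y : t != 0 ->
  is_derive t 1 (fun s => f (s *: y)) (t^-1 * euler f (t *: y)).
Proof.
move=> t0.
rewrite (_ : t^-1 * _ = \sum_(i < n) y ord0 i * partial i f (t *: y)).
  apply: (smooth_is_derive_curve (g := fun s => s *: y)); first exact: smooth_funP.
  move=> i; rewrite (_ : (fun s => _) = y ord0 i \*: id); last first.
    by apply/funext => s; rewrite mxE mulrC.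
  by apply: is_derive_eq; exact: mulr1.
rewrite /euler smooth_sum mulr_sumr; apply: eq_bigr => i _.
by rewrite smoothM pdE/= !mxE; field.
Qed.

Lemma is_derive_dball_integral (F dF : R -> 'rV[R]_n -> R) (a u v M : R) :
  u < a < v ->
  (forall s, u < s < v -> leb.-integrable (dball 1) (EFin \o F s)) ->
  (forall s z, u < s < v -> dball 1 z -> is_derive s 1 (F ^~ z) (dF s z)) ->
  (forall s z, u < s < v -> dball 1 z -> `|dF s z| <= M) ->
  is_derive a 1 (fun s => \int[leb]_(z in dball 1) F s z)
    (\int[leb]_(z in dball 1) dF a z).
Proof.
move=> ua Fi FD FM.
have md : measurable (dball 1 : set 'rV[R]_n) := measurable_dball 1.
have Ia : [set` `]u, v[] a by rewrite /= in_itv.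
have Mi : leb.-integrable (dball 1) (EFin \o cst `|M|).
  apply: (@measurable_bounded_integrable _ _ _ _ (cst `|M|)) => //; last exact: bounded_cst.
  exact: lebesgue_dball_lty.
have Fi' s : [set` `]u, v[] s -> leb.-integrable (dball 1) (EFin \o F s).
  by rewrite /= in_itv/=; exact: Fi.
have FD' s z : [set` `]u, v[] s -> dball 1 z -> derivable (F ^~ z) s 1.
  by rewrite /= in_itv/= => us zb; have [] := FD s z us zb.
have dFE s z : u < s < v -> dball 1 z -> partial1of2 F s z = dF s z.
  by move=> us zb; rewrite partial1of2E; have [_ ->] := FD s z us zb.
have FM' s z : [set` `]u, v[] s -> dball 1 z -> `|partial1of2 F s z| <= cst `|M| z.
  rewrite /= in_itv/= => us zb; rewrite dFE//.
  by rewrite (le_trans (FM s z us zb))// ler_norm.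
have M0 z : 0 <= cst `|M| (z : 'rV[R]_n) by rewrite /=.
apply: DeriveDef.
  exact: (derivable_under_integral md Ia Fi' FD' M0 Mi FM').
rewrite -derive1E (differentiation_under_integral md Ia Fi' FD' M0 Mi FM').
by apply: eq_Rintegral => z; rewrite inE => zb; exact: dFE.
Qed.

Lemma is_derive_smean f l : 0 < l ->
  is_derive l 1 (smean f) (l^-1 * smean (euler f) l).
Proof.
move=> l0.
have [M M0 fM] := continuous_ball_bounded (l * 2) (@smooth_fun_continuous (euler f)).
have D : is_derive l 1 (fun s => \int[leb]_(z in dball 1) f (s *: udir z))
    (\int[leb]_(z in dball 1) (l^-1 * euler f (l *: udir z))).
  (* On the window from [l / 2] to [2 l] the factor [s^-1] is bounded, so a constant dominates the
     derivative. *)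
  apply: (is_derive_dball_integral (F := fun s z => f (s *: udir z))
     (dF := fun s z => s^-1 * euler f (s *: udir z)) (u := l / 2) (v := l * 2) (M := (l / 2)^-1 * M)).
  - by apply/andP; split; lra.
  - by move=> s _; exact: integrable_smean.
  - by move=> s z /andP[ls _] _; apply: is_derive_radial; rewrite gt_eqF//; lra.
  - move=> s z /andP[ls sl] zb; have s0 : 0 < s by lra.
    rewrite normrM ler_pM//; last by apply: fM; rewrite enorm_scaled_udir// gtr0_norm// ltW.
    by rewrite gtr0_norm ?invr_gt0// lef_pV2 ?posrE ?ltW//; lra.
rewrite (RintegralZl _ (measurable_dball 1) (integrable_smean (euler f) l)) in D.
rewrite /smean mulrCA; exact: (is_deriveZ n%:R D).
Qed.

Definition rotrow (i j : 'I_n) (s : R) y : 'rV[R]_n := \row_k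
  (if k == i then cos s * y ord0 i - sin s * y ord0 j
   else if k == j then sin s * y ord0 i + cos s * y ord0 j else y ord0 k).

Section rotation.
Variables (i j : 'I_n).
Hypothesis ij : i != j.

Lemma rotrow_i s y : rotrow i j s y ord0 i = cos s * y ord0 i - sin s * y ord0 j.
Proof. by rewrite mxE eqxx. Qed.

Lemma rotrow_j s y : rotrow i j s y ord0 j = sin s * y ord0 i + cos s * y ord0 j.
Proof. by rewrite mxE eq_sym (negbTE ij) eqxx. Qed.

Lemma rotrow_k s y k : k != i -> k != j -> rotrow i j s y ord0 k = y ord0 k.
Proof. by move=> ki kj; rewrite mxE (negbTE ki) (negbTE kj). Qed.

Lemma rotrowD s : {morph rotrow i j s : x y / x + y}.
Proof.
by move=> x y; apply/rowP => k; rewrite !mxE; case: eqP => _; [|case: eqP => _ //]; ring.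
Qed.

Lemma rotrowZ s (c : R) y : rotrow i j s (c *: y) = c *: rotrow i j s y.
Proof.
by apply/rowP => k; rewrite !mxE; case: eqP => _; [|case: eqP => _ //]; ring.
Qed.

Lemma rotrow0 y : rotrow i j 0 y = y.
Proof.
apply/rowP => k; rewrite mxE sin0 cos0 !mul0r !mul1r subr0 add0r.
by case: eqP => [->//|_]; case: eqP => [->|].
Qed.

Lemma rotrow_surj s v : exists w, rotrow i j s w = v.
Proof.
exists (rotrow i j (- s) v); apply/rowP => k.
have cs := cos2Dsin2 s.
have [->|ki] := eqVneq k i.
  rewrite rotrow_i rotrow_i rotrow_j sinN cosN -[RHS]mul1r -cs; ring.
have [->|kj] := eqVneq k j.
  rewrite rotrow_j rotrow_i rotrow_j sinN cosN -[RHS]mul1r -cs; ring.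
by rewrite !rotrow_k.
Qed.

Lemma sum_split_ij (F : 'I_n -> R) :
  \sum_k F k = F i + F j + \sum_(k | (k != i) && (k != j)) F k.
Proof. by rewrite (bigD1 i)//= (bigD1 j)/= ?addrA// eq_sym. Qed.

Lemma enorm_rotrow s y : enorm (rotrow i j s y) = enorm y.
Proof.
congr Num.sqrt; rewrite /edot !sum_split_ij; congr (_ + _); last first.
  by apply: eq_bigr => k /andP[ki kj]; rewrite rotrow_k.
rewrite rotrow_i rotrow_j -[RHS]mul1r -(cos2Dsin2 s); ring.
Qed.

Lemma measurable_rotrow s : measurable_fun setT (rotrow i j s).
Proof.
apply: measurable_fun_rVP => k.
have mc c (h : 'I_n) : measurable_fun setT
    (fun y : 'rV[R]_n => c * y ord0 h : measurableTypeR R).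
  by apply: measurable_funM => //; exact: measurable_coor.
have [->|ki] := eqVneq k i.
  by under eq_fun do rewrite rotrow_i; apply: measurable_funB; exact: mc.
have [->|kj] := eqVneq k j.
  by under eq_fun do rewrite rotrow_j; apply: measurable_funD; exact: mc.
under eq_fun do rewrite rotrow_k//; exact: measurable_coor.
Qed.

Definition rotgen y : 'rV[R]_n :=
  \row_k (if k == i then - y ord0 j else if k == j then y ord0 i else 0).

Lemma is_derive_rotrow (s : R) y k : is_derive s 1 (fun t => rotrow i j t y ord0 k)
  (rotgen (rotrow i j s y) ord0 k).
Proof.
rewrite /rotgen mxE rotrow_i rotrow_j.
have [->|ki] := eqVneq k i.
  rewrite (_ : (fun t => _) = (fun t => cos t * y ord0 i - sin t * y ord0 j)); last first.
    by apply/funext => t; rewrite rotrow_i.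
  by apply: is_derive_eq; rewrite -![_ *: _]/(_ * _) /=; ring.
have [->|kj] := eqVneq k j.
  rewrite (_ : (fun t => _) = (fun t => sin t * y ord0 i + cos t * y ord0 j)); last first.
    by apply/funext => t; rewrite rotrow_j.
  by apply: is_derive_eq; rewrite -![_ *: _]/(_ * _) /=; ring.
rewrite (_ : (fun t => _) = cst (y ord0 k)); last first.
  by apply/funext => t; rewrite rotrow_k.
exact: is_derive_cst.
Qed.

(* The mean of [f] over the rotated sphere does not depend on the angle. *)
Lemma smean_angular f l : smean (angular i j f) l = 0.
Proof.
have [M M0 fM] := continuous_ball_bounded `|l| (@smooth_fun_continuous (angular i j f)).
have D : is_derive (0 : R) 1
    (fun s => \int[leb]_(z in dball 1) f (rotrow i j s (l *: udir z)))
    (\int[leb]_(z in dball 1) (angular i j f (rotrow i j 0 (l *: udir z)))).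
  apply: (is_derive_dball_integral (F := fun s z => f (rotrow i j s (l *: udir z)))
     (dF := fun s z => angular i j f (rotrow i j s (l *: udir z))) (u := -1) (v := 1) (M := M)).
  - by apply/andP; split; lra.
  - move=> s _.
    apply: (@integrable_dball _ _ f (fun z => rotrow i j s (l *: udir z)) (dball 1) `|l|).
    + exact: measurable_dball.
    + exact: lebesgue_dball_lty.
    + exact: smooth_fun_continuous.
    + apply: (measurableT_comp (measurable_rotrow s)); exact: measurable_scaled_udir.
    + by move=> z zb; rewrite enorm_rotrow enorm_scaled_udir.
  - move=> s z _ zb; set y := l *: udir z.
    have E w : \sum_k rotgen w ord0 k * partial k f w = angular i j f w.
      rewrite sum_split_ij big1 ?addr0; last first.
        by move=> k /andP[ki kj]; rewrite mxE (negbTE ki) (negbTE kj) mul0r.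
      rewrite [rotgen w _ i]mxE [rotgen w _ j]mxE !eqxx eq_sym (negbTE ij).
      by rewrite /angular !smoothE !pdE/=; ring.
    have := smooth_is_derive_curve (smooth_funP f) (fun k => is_derive_rotrow s y k).
    by rewrite E.
  - by move=> s z _ zb; apply: fM; rewrite enorm_rotrow enorm_scaled_udir.
(* A rotation commutes with dilations and with [udir], so rotating the argument of [f] amounts to
   rotating [z], which leaves the integral over the ball unchanged. *)
have C s : \int[leb]_(z in dball 1) f (rotrow i j s (l *: udir z))
    = \int[leb]_(z in dball 1) f (l *: udir z).
  have cf : continuous (affine 0 l f) by exact: smooth_fun_continuous.
  have := Rintegral_isometry cf (measurable_rotrow s) (@rotrowD s)
    (rotrow_surj s) (enorm_rotrow s).
  under eq_Rintegral do rewrite affine0E.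
  under [in X in _ = X -> _]eq_Rintegral do rewrite affine0E.
  move=> <-; apply: eq_Rintegral => z _.
  by rewrite {2}/udir enorm_rotrow -rotrowZ -rotrowZ.
have [_] := D; rewrite (_ : (fun s => _) = cst (\int[leb]_(z in dball 1) f (l *: udir z))).
  rewrite derive_cst => E; rewrite /smean.
  rewrite -[X in _ * X](_ : \int[leb]_(z in dball 1) (angular i j f (rotrow i j 0 (l *: udir z))) = _).
    by rewrite -E mulr0.
  by apply: eq_Rintegral => z _; rewrite rotrow0.
by apply/funext => s; rewrite C.
Qed.

End rotation.

Lemma smean_green f g l : smean (sphgrad2 f g + f * sphlap g) l = 0.
Proof.
have two : smean (2 * (sphgrad2 f g + f * sphlap g)) l = 0.
  rewrite -sum_angular_green smean_sum big1// => i _.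
  rewrite smean_sum big1// => j _.
  (* A rotation needs two distinct axes, so the diagonal terms, which are 0, are set apart. *)
  have [<-|ij] := eqVneq i j; last exact: smean_angular.
  by rewrite (_ : angular i i _ = 0) ?smean0// /angular subrr.
move: two; rewrite mulr_natl mulr2n [LHS in LHS = _ -> _]smeanD.
move: (smean _ l) => w; lra.
Qed.

(** Self-adjointness: the gradient term of Green's formula is symmetric in [f] and [g]. *)
Lemma smean_sphlapC f g l : smean (f * sphlap g) l = smean (g * sphlap f) l.
Proof.
have := smean_green f g l; have := smean_green g f l.
rewrite (sphgrad2C g f).
by rewrite !smeanD => /eqP; rewrite addr_eq0 => /eqP -> /eqP; rewrite addrC subr_eq0 => /eqP.
Qed.

End spherical_mean.

(** * Integrals over balls *)

Section ball_integral.
Context {R : realType} {n : nat}.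
Local Notation A := (smoothFun R n).
Local Notation leb := (@lebesgue_rV R n).
Implicit Types (y z : 'rV[R]_n) (f g h : A) (l r : R).

Lemma lebesgue_dball r : 0 < r ->
  fine (leb (dball r)) = r ^+ n * fine (leb (dball 1)).
Proof.
move=> r0; rewrite -(lebesgue_rV_aff (n := n) 0 r0 (measurable_dball r)).
rewrite (_ : affrV r 0 @^-1` dball r = dball 1).
  rewrite fineM// ge0_fin_numE ?measure_ge0//; exact: lebesgue_dball_lty.
apply/seteqP; split=> z; rewrite /affrV /dball/= addr0 enormZ gtr0_norm//;
  by rewrite pmulr_rgt0// -{2}[r]mulr1 ltr_pM2l.
Qed.

Lemma Rintegral_scaled_udir h l r : 0 < r ->
  \int[leb]_(z in dball r) h (l *: udir z) =
  r ^+ n * \int[leb]_(z in dball 1) h (l *: udir z).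
Proof.
move=> r0.
have rn0 : 0 <= r ^+ n by exact/ltW/exprn_gt0.
have mT := @measurable_affrV R n r 0.
have TD : affrV r 0 @^-1` dball r = (dball 1 : set 'rV[R]_n).
  apply/seteqP; split=> z; rewrite /affrV /dball/= addr0 enormZ gtr0_norm//;
  by rewrite pmulr_rgt0// -{2}[r]mulr1 ltr_pM2l.
have TE (z : 'rV[R]_n) : udir (affrV r 0 z) = udir z by rewrite /affrV addr0 udirZ.
have mh : measurable_fun setT ((fun z => h (l *: udir z)) : 'rV[R]_n -> measurableTypeR R).
  apply: (measurableT_comp (f := h)); last exact: measurable_scaled_udir.
  exact: continuous_measurable_rV (@smooth_fun_continuous _ _ h).
rewrite (@Rintegral_transfer _ _ _ _ R leb _ _ _ (NngNum rn0) _ (measurable_dball r) mT mh) ?TD/=.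
- by congr (_ * _); apply: eq_Rintegral => z _; rewrite TE.
- by move=> B mB _; rewrite lebesgue_rV_aff.
- apply: eq_integrable (integrable_smean h l); first exact: measurable_dball.
  by move=> z _ /=; rewrite TE.
Qed.

Definition annulus (a b : R) : set 'rV[R]_n := [set z | a <= enorm z < b].

Lemma measurable_annulus a b : measurable (annulus a b).
Proof.
rewrite (_ : annulus a b = (fun y : 'rV[R]_n => enorm (y - 0)) @^-1` `[a, b[%classic).
  rewrite -[X in measurable X]setTI.
  by apply: measurable_enorm => //; exact: measurable_itv.
by apply/seteqP; split=> y /=; rewrite in_itv/= subr0.
Qed.

Lemma eball_annulus a b : a <= b -> eball 0 b = eball 0 a `|` annulus a b.
Proof.
move=> ab; apply/seteqP; split=> z; rewrite /eball /annulus/= subr0.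
  by move=> zb; have [za|az] := ltP (enorm z) a; [left|right; rewrite zb].
by move=> [za|/andP[]//]; exact: lt_le_trans ab.
Qed.

Lemma dball_annulus a b : 0 < a -> a <= b -> dball b = dball a `|` annulus a b.
Proof.
move=> a0 ab; apply/seteqP; split=> z; rewrite /dball /annulus/=.
  by move=> /andP[z0 zb]; have [za|az] := ltP (enorm z) a; [left; rewrite z0|right; rewrite zb].
move=> [/andP[-> za]|/andP[az ->]]; first exact: lt_le_trans ab.
by rewrite (lt_le_trans a0).
Qed.

Lemma lebesgue_annulus_lty a b : (leb (annulus a b) < +oo)%E.
Proof.
apply: le_lt_trans (lebesgue_eball_lty n b); apply: le_measure; rewrite ?inE.
- exact: measurable_annulus.
- exact: measurable_eball.
- by move=> y /= /andP[]; rewrite /eball/= subr0.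
Qed.

Lemma lebesgue_annulus a b : 0 < a -> a <= b ->
  fine (leb (annulus a b)) = (b ^+ n - a ^+ n) * fine (leb (dball 1)).
Proof.
move=> a0 ab; rewrite mulrBl -!lebesgue_dball//; last exact: lt_le_trans ab.
rewrite (dball_annulus a0 ab) measureU; first last.
- rewrite -subset0 => z [] /=; rewrite /dball /annulus/= => /andP[_ za] /andP[az _].
  by move: (lt_le_trans za az); rewrite ltxx.
- exact: measurable_annulus.
- exact: measurable_dball.
rewrite fineD ?ge0_fin_numE ?measure_ge0//.
- by rewrite addrAC subrr add0r.
- exact: lebesgue_dball_lty.
- exact: lebesgue_annulus_lty.
Qed.

Lemma integrable_eball h r D : measurable D -> D `<=` eball 0 r ->
  leb.-integrable D (EFin \o h).
Proof.
move=> mD Dr; apply: (@integrable_dball _ _ h id D r) => //.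
- apply: le_lt_trans (lebesgue_eball_lty n r); apply: le_measure; rewrite ?inE//.
  exact: measurable_eball.
- exact: smooth_fun_continuous.
- by move=> z /Dr; rewrite /eball/= subr0 => /ltW.
Qed.

Lemma integrable_scaled_udir h l r D : measurable D -> D `<=` eball 0 r ->
  (forall z, D z -> 0 < enorm z) ->
  leb.-integrable D (EFin \o (fun z => h (l *: udir z))).
Proof.
move=> mD Dr D0; apply: (@integrable_dball _ _ h (fun z => l *: udir z) D `|l|) => //.
- apply: le_lt_trans (lebesgue_eball_lty n r); apply: le_measure; rewrite ?inE//.
  exact: measurable_eball.
- exact: smooth_fun_continuous.
- exact: measurable_scaled_udir.
- by move=> z /D0 z0; rewrite enormZ enorm_udir// mulr1.
Qed.

Lemma ball_integral_diff h a b : a <= b ->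
  \int[leb]_(z in eball 0 b) h z - \int[leb]_(z in eball 0 a) h z
  = \int[leb]_(z in annulus a b) h z.
Proof.
move=> ab; rewrite (eball_annulus ab) Rintegral_setU.
- by rewrite addrAC subrr add0r.
- exact: measurable_eball.
- exact: measurable_annulus.
- rewrite -(eball_annulus ab); apply: (@integrable_eball _ b) => //.
  exact: measurable_eball.
- apply/disj_setPS => z [] /=; rewrite /eball /annulus/= subr0 => za /andP[az _].
  by move: (lt_le_trans za az); rewrite ltxx.
Qed.

Lemma dball_integral_diff h l a b : 0 < a -> a <= b ->
  (b ^+ n - a ^+ n) * \int[leb]_(z in dball 1) h (l *: udir z)
  = \int[leb]_(z in annulus a b) h (l *: udir z).
Proof.
move=> a0 ab; rewrite mulrBl -!Rintegral_scaled_udir//; last exact: lt_le_trans ab.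
rewrite (dball_annulus a0 ab) Rintegral_setU.
- by rewrite addrAC subrr add0r.
- exact: measurable_dball.
- exact: measurable_annulus.
- rewrite -(dball_annulus a0 ab); apply: (@integrable_scaled_udir _ _ b) => //.
  + exact: measurable_dball.
  + by move=> z /andP[_]; rewrite /eball/= subr0.
  + by move=> z /andP[].
- apply/disj_setPS => z [] /=; rewrite /dball /annulus/= => /andP[_ za] /andP[az _].
  by move: (lt_le_trans za az); rewrite ltxx.
Qed.

Lemma radial_lipschitz h l : 0 < l -> exists2 C, 0 <= C &
  forall (s t : R) y, enorm y = 1 -> 0 < s -> s <= t -> t <= l * 2 -> l / 2 <= s ->
    `|h (t *: y) - h (s *: y)| <= C * (t - s).
Proof.
move=> l0.
have [M M0 fM] := continuous_ball_bounded (l * 2) (@smooth_fun_continuous R n (euler h)).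
exists ((l / 2)^-1 * M); first by rewrite mulr_ge0// invr_ge0 divr_ge0// ltW.
move=> s t y y1 s0 st tl ls.
have D (x : R) : 0 < x -> is_derive x 1 (fun a => h (a *: y)) (x^-1 * euler h (x *: y)).
  by move=> x0; apply: is_derive_radial; rewrite gt_eqF.
have [||c] := @MVT_segment R (fun a => h (a *: y)) (fun x => x^-1 * euler h (x *: y)) s t st.
- by move=> x; rewrite in_itv/= => /andP[sx _]; apply: D; exact: lt_trans sx.
- apply: derivable_within_continuous => x; rewrite in_itv/= => /andP[sx _].
  by have [] := D x (lt_le_trans s0 sx).
rewrite in_itv/= => /andP[sc ct] ->.
rewrite normrM (ger0_norm (_ : 0 <= t - s)) ?subr_ge0//.
rewrite ler_wpM2r ?subr_ge0// normrM.
have c0 : 0 < c := lt_le_trans s0 sc.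
apply: ler_pM => //.
  by rewrite gtr0_norm ?invr_gt0// lef_pV2 ?posrE ?divr_gt0// (le_trans ls).
by apply: fM; rewrite enormZ y1 mulr1 gtr0_norm// (le_trans ct).
Qed.

(** [h] is compared with the function [h (l *: udir z)], constant along rays, whose integral over a
    punctured ball is an explicit power of the radius. On an annulus meeting radius [l] the two
    differ by [O(b - a)], and the volume of the annulus supplies a second small factor, so the
    difference does not contribute to the derivative. *)
Lemma ball_integral_remainder h l : 0 < l -> exists C, 0 <= C /\
  forall a b : R, l / 2 <= a -> a <= b -> b <= l * 2 -> a <= l <= b ->
  `|(\int[leb]_(z in eball 0 b) h z - b ^+ n * \int[leb]_(z in dball 1) h (l *: udir z))
    - (\int[leb]_(z in eball 0 a) h z - a ^+ n * \int[leb]_(z in dball 1) h (l *: udir z))|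
  <= C * (b - a) * (b ^+ n - a ^+ n).
Proof.
move=> l0; have [C C0 hC] := radial_lipschitz h l0.
have c0 : 0 <= fine (leb (dball 1)) by exact/fine_ge0/measure_ge0.
exists (C * fine (leb (dball 1))); split; first exact: mulr_ge0.
move=> a b la ab bl /andP[al lb].
have a0 : 0 < a by apply: lt_le_trans la; rewrite divr_gt0.
have ma := measurable_annulus a b.
have annb : annulus a b `<=` @eball R n 0 b.
  by move=> z /andP[_]; rewrite /eball/= subr0.
have ann0 z : annulus a b z -> 0 < enorm z by move=> /andP[az _]; exact: lt_le_trans az.
have ih := integrable_eball h ma annb.
have iH := integrable_scaled_udir h l ma annb ann0.
rewrite (_ : _ - _ = \int[leb]_(z in annulus a b) (h z - h (l *: udir z))); last first.
  rewrite (RintegralB ma ih iH) -(ball_integral_diff h ab) -(dball_integral_diff h l a0 ab).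
  ring.
have id : leb.-integrable (annulus a b) (EFin \o (fun z => h z - h (l *: udir z))).
  exact: (integrableB ma ih iH).
apply: (le_trans (le_normr_Rintegral ma id)).
rewrite (_ : C * _ * _ * _ = \int[leb]_(z in annulus a b) (C * (b - a))); last first.
  rewrite (Rintegral_cst leb ma (C * (b - a))) lebesgue_annulus//; ring.
apply: le_Rintegral => //.
- exact: integrable_norm.
- apply: (@measurable_bounded_integrable _ _ _ _ (cst (C * (b - a)))) => //.
    exact: lebesgue_annulus_lty.
  exact: bounded_cst.
move=> z zab; have /andP[az zb] := zab; have z0 := ann0 z zab.
rewrite {1}[z](udirK z0); have [lz|zl] := leP l (enorm z).
  apply: le_trans (hC l (enorm z) (udir z) _ _ _ _ _) _ => //.
  - exact: enorm_udir.
  - exact: le_trans (ltW zb) bl.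
  - by clear -l0; lra.
  - by rewrite ler_wpM2l// lerB// ltW.
rewrite distrC.
apply: le_trans (hC (enorm z) l (udir z) _ _ _ _ _) _ => //.
- exact: enorm_udir.
- exact: ltW.
- by clear -l0; lra.
- exact: le_trans az.
- by rewrite ler_wpM2l// lerB.
Qed.

(** Only the comparison term [r^n J] has a nonzero derivative at [l], namely [n l^(n-1) J]; the
    factor [n] is the one in [smean]. *)
Lemma is_derive_ball_integral h l : (0 < n)%N -> 0 < l ->
  is_derive l 1 (fun r => \int[leb]_(z in eball 0 r) h z) (l ^+ n.-1 * smean h l).
Proof.
move=> n0 l0; have [C [C0 hC]] := ball_integral_remainder h l0.
pose J := \int[leb]_(z in dball 1) h (l *: udir z).
pose K (r : R) := \int[leb]_(z in eball 0 r) h z - r ^+ n * J.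
have Kd : is_derive l 1 K 0.
  (* Divided by [|e|], the remainder is at most [C |(l + e)^n - l^n|]. The remainder bound is
     ordered in its endpoints, whence the two signs of [e]. *)
  have lim0 : (fun e : R => e^-1 *: ((K \o shift l) (e *: 1) - K l)) @ 0^' --> (0 : R).
    have cvg0 : (fun e : R => C * `|(e + l) ^+ n - l ^+ n|) @ 0^' --> (0 : R).
      have E0 : C * `|l ^+ n - l ^+ n| = 0 by rewrite subrr normr0 mulr0.
      rewrite -[X in _ --> X]E0.
      apply: cvgM; first exact: cvg_cst.
      apply: cvg_norm; apply: cvgB; last exact: cvg_cst.
      apply: cvg_within_filter.
      have cX : continuous (fun e : R => (e + l) ^+ n).
        move=> e; apply: (@continuous_comp _ _ _ (fun e => e + l) (fun x => x ^+ n)).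
          by apply: continuousD => //; exact: cst_continuous.
        exact: exprn_continuous.
      by have := cX 0; rewrite /continuous_at add0r.
    apply: norm_cvg0.
    apply: (@squeeze_cvgr _ _ _ _ (cst 0) (fun e : R => C * `|(e + l) ^+ n - l ^+ n|)) => //; last exact: cvg_cst.
    have l20 : 0 < l / 2 by rewrite divr_gt0.
    near=> e; rewrite /= normr_ge0/=.
    have e0 : e != 0 by near: e; exact: nbhs_dnbhs_neq.
    have el : `|e| < l / 2 by near: e; exact: dnbhs0_lt.
    rewrite -[e *: 1]/(e * 1) mulr1 -[_ *: _]/(_ * _) normrM normfV.
    rewrite ler_pdivrMl ?normr_gt0// mulrA (mulrC `|e|).
    move: el; rewrite ltr_norml => /andP[el1 el2].
    have [e0'|e0'] := ltP 0 e.
      have := hC l (e + l); rewrite -/J -/(K l) -/(K (e + l)).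
      rewrite addrK (gtr0_norm e0').
      rewrite (ger0_norm (_ : 0 <= (e + l) ^+ n - l ^+ n)); last first.
        by rewrite subr_ge0 lerXn2r ?nnegrE; lra.
      by apply; lra.
    have e1 : e < 0 by rewrite lt_neqAle e0.
    have := hC (e + l) l; rewrite -/J -/(K l) -/(K (e + l)).
    have -> : l - (e + l) = - e by ring.
    rewrite distrC (ltr0_norm e1).
    rewrite (ler0_norm (_ : (e + l) ^+ n - l ^+ n <= 0)); last first.
      by rewrite subr_le0 lerXn2r ?nnegrE; lra.
    rewrite [X in _ -> _ <= _ * X]opprB; apply; lra.
  by apply: DeriveDef; [apply/cvg_ex; exists 0|exact/cvg_lim].
have Jd : is_derive l 1 (fun r : R => r ^+ n * J) (n%:R * l ^+ n.-1 * J).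
  have Xd : is_derive l 1 (fun r : R => r ^+ n) (n%:R * l ^+ n.-1).
    apply: DeriveDef; first exact: exprn_derivable.
    by rewrite exp_derive -![_ *: _]/(_ * _) mulr1.
  have := is_deriveZ J Xd; rewrite [J *: _]mulrC.
  by rewrite (_ : J \*: _ = fun r => r ^+ n * J)//; apply/funext => r; exact: mulrC.
have := is_deriveD Kd Jd; rewrite add0r.
rewrite (_ : K + _ = fun r => \int[leb]_(z in eball 0 r) h z); last first.
  by apply/funext => r; rewrite /K /= -[LHS]/(_ - _ + _) subrK.
by rewrite /smean -/J mulrCA mulrA.
Unshelve. all: by end_near. Qed.

End ball_integral.

(** * The flux identity for triharmonic functions *)

Section more_algebra.
Context {R : realType} {n : nat}.
Local Notation A := (smoothFun R n).
Implicit Types (f g v : A).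
Local Notation N := (n%:R : A).

Lemma euler_sum (I : Type) (r : seq I) (F : I -> A) :
  euler (\sum_(i <- r) F i) = \sum_(i <- r) euler (F i).
Proof. exact: raddf_sum. Qed.

Lemma eulerD f g : euler (f + g) = euler f + euler g. Proof. exact: raddfD. Qed.

Lemma sphlapD f g : sphlap (f + g) = sphlap f + sphlap g. Proof. exact: raddfD. Qed.

Lemma euler_sphgrad2 f g :
  euler (sphgrad2 f g) = sphgrad2 (euler f) g + sphgrad2 f (euler g).
Proof.
rewrite !sphgrad2E eulerB !eulerM euler_sqnorm euler_sum.
have -> : \sum_i euler (pd i f * pd i g) =
    \sum_i pd i (euler f) * pd i g + \sum_i pd i f * pd i (euler g)
    - 2 * \sum_i pd i f * pd i g.
  rewrite mulr_sumr -big_split -sumrB/=; apply: eq_bigr => i _.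
  by rewrite eulerM !pd_euler; ring.
ring.
Qed.

Lemma sphlapMn f k : sphlap (k%:R * f) = k%:R * sphlap f.
Proof. by rewrite mulr_natl raddfMn mulr_natl. Qed.

(** The powers of [|y|^2] make the Laplacian and its square homogeneous of degree 0, so that they
    become polynomials in E and L. At [l *: y] with [y] on the unit sphere, [dtri v] is the
    Laplacian of the blowup. *)
Definition dtri v : A := sqnorm * slap v.
Definition dtri2 v : A := sqnorm * (sqnorm * slap (slap v)).

(** Conjugation by [|y|^2] replaces E by E - 2 in [E^2 + (n-2) E + L]; the next lemma replaces it by
    E - 4 in the same way. *)
Lemma sqnorm_slap2 f : sqnorm * (sqnorm * slap f) =
  euler (euler (sqnorm * f)) + (N - 6) * euler (sqnorm * f)
  - 2 * (N - 4) * (sqnorm * f) + sphlap (sqnorm * f).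
Proof.
rewrite sphlap_sqnormM sqnorm_slap !eulerM euler_sqnorm eulerD !eulerM !euler_sqnorm euler_nat.
ring.
Qed.

Lemma sqnorm_slap3 f : sqnorm * (sqnorm * (sqnorm * slap f)) =
  euler (euler (sqnorm * (sqnorm * f))) + (N - 10) * euler (sqnorm * (sqnorm * f))
  - 4 * (N - 6) * (sqnorm * (sqnorm * f)) + sphlap (sqnorm * (sqnorm * f)).
Proof.
rewrite sqnorm_slap2 !sphlap_sqnormM.
have E1 : euler (sqnorm * (sqnorm * f)) = 2 * (sqnorm * (sqnorm * f))
    + sqnorm * euler (sqnorm * f) by rewrite eulerM euler_sqnorm; ring.
have E2 : euler (euler (sqnorm * (sqnorm * f))) = 4 * (sqnorm * (sqnorm * f))
    + 4 * (sqnorm * euler (sqnorm * f)) + sqnorm * euler (euler (sqnorm * f)).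
  rewrite E1 eulerD eulerMn E1 [euler (sqnorm * euler _)]eulerM euler_sqnorm; ring.
by rewrite E2 E1; ring.
Qed.

Definition gradlap2 v : A := \sum_i pd i (slap v) * pd i (slap v).

Lemma sphgrad2_sqnormM f : sphgrad2 (sqnorm * f) (sqnorm * f) =
  sqnorm * (sqnorm * sphgrad2 f f).
Proof.
rewrite !sphgrad2E !eulerM euler_sqnorm.
have E i : pd i (sqnorm * f) * pd i (sqnorm * f) =
   4 * (f * f) * (scoor i * scoor i) + 4 * (sqnorm * f) * (scoor i * pd i f)
   + sqnorm * sqnorm * (pd i f * pd i f).
  by rewrite pdM pd_sqnorm; ring.
under eq_bigr => i _ do rewrite E.
rewrite !big_split/= -!mulr_sumr -/sqnorm -/(euler f); ring.
Qed.

Lemma sqnorm3_gradlap2 v : sqnorm * (sqnorm * (sqnorm * gradlap2 v)) =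
  (euler (dtri v) - 2 * dtri v) * (euler (dtri v) - 2 * dtri v)
  + sphgrad2 (dtri v) (dtri v).
Proof.
rewrite /dtri sphgrad2_sqnormM sphgrad2E -/(gradlap2 v) eulerM euler_sqnorm; ring.
Qed.

(** Up to powers of the radius the terms are [d_r (Delta v) Delta phi], [- Delta^2 v d_r phi] and
    [d_r (Delta^2 v) phi] for [phi = E v], the boundary terms of the three integrations by parts.
    The shifts by 2 and 4 compensate the weights in [dtri] and [dtri2]. *)
Definition boundary_flux v : A :=
  (euler (dtri v) - 2 * dtri v) * euler (dtri v) - dtri2 v * euler (euler v)
  + (euler (dtri2 v) - 4 * dtri2 v) * euler v.

(* With [Q = sqnorm^3 * gradlap2 v], integrating over spheres and using
   [Delta^3 v = 0], [E Q / 2 = (E + n - 6) boundary_flux] up to terms of zero mean. *)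
Lemma flux_identity v : slap (slap (slap v)) = 0 ->
  euler (sqnorm * (sqnorm * (sqnorm * gradlap2 v)))
    - 2 * euler (boundary_flux v) - 2 * ((N - 6) * boundary_flux v) =
  2 * ((sphgrad2 (euler (dtri v)) (dtri v) + euler (dtri v) * sphlap (dtri v))
   + (euler v * sphlap (dtri2 v) - dtri2 v * sphlap (euler v))).
Proof.
move=> v3.
have w3 := sqnorm_slap3 (slap (slap v)); rewrite v3 !mulr0 in w3.
have w2 := sqnorm_slap2 (slap v); rewrite -/(dtri2 v) -/(dtri v) in w2 w3.
have w1 : euler (dtri v) = euler (euler (euler v)) + (N - 2) * euler (euler v)
    + sphlap (euler v).
  by rewrite /dtri sqnorm_slap !eulerD eulerM eulerB !euler_nat euler_sphlap; ring.
(* The three relations are solved for the spherical Laplacians; substituting them leaves an identity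
   in the Euler operator and the tangential products alone. *)
have w3' : sphlap (dtri2 v) = 4 * (N - 6) * dtri2 v - (N - 10) * euler (dtri2 v)
    - euler (euler (dtri2 v)).
  by apply/eqP; rewrite -subr_eq0; apply/eqP; rewrite [RHS]w3; ring.
have w2' : sphlap (dtri v) = dtri2 v - euler (euler (dtri v)) - (N - 6) * euler (dtri v)
    + 2 * (N - 4) * dtri v by rewrite w2; ring.
have w1' : sphlap (euler v) = euler (dtri v) - euler (euler (euler v))
    - (N - 2) * euler (euler v) by rewrite w1; ring.
rewrite sqnorm3_gradlap2 /boundary_flux; move: (dtri v) (dtri2 v) w1 w2 w3 w3' w2' w1' => w z _ _ _ w3' w2' w1'.
rewrite !(eulerB, eulerD, eulerM, euler_nat, euler_sphgrad2).
rewrite (sphgrad2C w) w3' w2' w1'.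
ring.
Qed.

End more_algebra.

(** * The rescaled volume energy as a spherical mean *)

Section energy.
Context {R : realType} {n : nat}.
Local Notation A := (smoothFun R n).
Local Notation leb := (@lebesgue_rV R n).
Implicit Types (f g h v : A) (l r : R) (y z : 'rV[R]_n).
Local Notation N := (n%:R : A).

Lemma eq_smean f g l : (forall y, enorm y = 1 -> f (l *: y) = g (l *: y)) ->
  smean f l = smean g l.
Proof.
by move=> fg; apply/eqP; rewrite eq_le !le_smean// => y y1; rewrite fg.
Qed.

Lemma sqnormE y : (sqnorm : A) y = edot y y.
Proof. by rewrite /sqnorm smooth_sum. Qed.

Lemma sqnorm_scaled l y : enorm y = 1 -> (sqnorm : A) (l *: y) = l ^+ 2.
Proof.
by move=> y1; rewrite sqnormE -enorm_sqr enormZ y1 mulr1 -normrX ger0_norm// sqr_ge0.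
Qed.

Lemma smean_sqnorm f l : smean (sqnorm * f) l = l ^+ 2 * smean f l.
Proof.
rewrite -smeanZ; apply: eq_smean => y y1.
by rewrite !smoothM sqnorm_scaled// smooth_sconst.
Qed.

Lemma smean_nat k f l : smean (k%:R * f) l = k%:R * smean f l.
Proof. by rewrite -smeanZ rmorph_nat. Qed.

Lemma smean_nat_sub k j f l : smean ((k%:R - j%:R) * f) l = (k%:R - j%:R) * smean f l.
Proof. by rewrite !mulrBl smeanB !smean_nat. Qed.

Lemma smean_flux v l : slap (slap (slap v)) = 0 ->
  smean (euler (sqnorm * (sqnorm * (sqnorm * gradlap2 v)))) l
  - 2 * smean (euler (boundary_flux v)) l = 2 * ((n%:R - 6) * smean (boundary_flux v) l).
Proof.
move=> v3; have /(congr1 (fun f => smean f l)) := flux_identity v3.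
rewrite !smeanB [RHS]smean_nat smeanD smean_green add0r smeanB.
rewrite (smean_sphlapC (euler v)) subrr mulr0 !smean_nat smean_nat_sub.
by move/eqP; rewrite subr_eq0 => /eqP.
Qed.

Lemma ball_integral_cvg0 h : exists2 M : R, 0 <= M & forall s, 0 < s -> s <= 1 ->
  `|\int[leb]_(z in eball 0 s) h z| <= s ^+ n * M.
Proof.
have [M M0 hM] := continuous_ball_bounded 1 (@smooth_fun_continuous R n h).
have c0 : 0 <= fine (leb (eball 0 1)) by exact/fine_ge0/measure_ge0.
exists (fine (leb (eball 0 1)) * M); first exact: mulr_ge0.
move=> s s0 s1.
have mb := @measurable_eball R n 0 s.
have hi := integrable_eball h mb (@subset_refl _ (eball 0 s)).
apply: (le_trans (le_normr_Rintegral mb hi)).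
have cE : fine (leb (eball 0 s)) = s ^+ n * fine (leb (eball 0 1)).
  rewrite -(lebesgue_rV_aff (n := n) 0 s0 mb) (_ : affrV s 0 @^-1` eball 0 s = eball 0 1).
    by rewrite fineM// ge0_fin_numE ?measure_ge0//; exact: lebesgue_eball_lty.
  apply/seteqP; split=> z; rewrite /affrV /eball/= addr0 !subr0 enormZ gtr0_norm//;
    by rewrite -{2}[s]mulr1 ltr_pM2l.
rewrite (_ : s ^+ n * _ = \int[leb]_(z in eball 0 s) M); last first.
  by rewrite (Rintegral_cst leb mb M) cE; ring.
apply: le_Rintegral => //.
- exact: integrable_norm.
- apply: (@measurable_bounded_integrable _ _ _ _ (cst M)) => //.
    exact: lebesgue_eball_lty.
  exact: bounded_cst.
by move=> z; rewrite /eball/= subr0 => zs; apply: hM; rewrite (le_trans (ltW zs)).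
Qed.

Lemma constant_of_derive0 (f : R -> R) (a b : R) : 0 < a -> a <= b ->
  (forall x : R, 0 < x -> is_derive x 1 f 0) -> f b = f a.
Proof.
move=> a0 ab fD.
have [||c _] := @MVT_segment R f (fun=> 0) a b ab.
- by move=> x; rewrite in_itv/= => /andP[ax _]; apply: fD; exact: lt_trans ax.
- apply: derivable_within_continuous => x; rewrite in_itv/= => /andP[ax _].
  by have [] := fD x (lt_le_trans a0 ax).
by rewrite mul0r => /eqP; rewrite subr_eq0 => /eqP.
Qed.

Lemma is_derive_powM (k : nat) (f : R -> R) (df l : R) :
  is_derive l 1 f df ->
  is_derive l 1 (fun r => r ^+ k * f r) (k%:R * l ^+ k.-1 * f l + l ^+ k * df).
Proof.
move=> fD.
have Xd : is_derive l 1 (fun r : R => r ^+ k) (k%:R * l ^+ k.-1).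
  apply: DeriveDef; first exact: exprn_derivable.
  by rewrite exp_derive -![_ *: _]/(_ * _) mulr1.
apply: (is_derive_eq (is_deriveM Xd fD)).
by rewrite -![_ *: _]/(_ * _) addrC [f l * _]mulrC.
Qed.

Hypothesis n7 : (7 <= n)%N.

(* Both sides have the same derivative in [l] and tend to 0 at 0. *)
Lemma ball_energy v l : slap (slap (slap v)) = 0 -> 0 < l ->
  (n%:R - 6) * \int[leb]_(z in eball 0 l) gradlap2 v z =
  l ^+ (n - 6) * smean (sqnorm * (sqnorm * (sqnorm * gradlap2 v)) - 2 * boundary_flux v) l.
Proof.
move=> v3 l0.
set Q := sqnorm * _; set G := Q - _.
pose phi (r : R) := r ^+ (n - 6) * smean G r - (n%:R - 6) * \int[leb]_(z in eball 0 r) gradlap2 v z.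
have phiD (r : R) : 0 < r -> is_derive r 1 phi 0.
  move=> r0.
  have D1 := is_derive_powM (n - 6) (is_derive_smean G r0).
  have D2 := is_deriveZ (n%:R - 6 : R) (is_derive_ball_integral (gradlap2 v) (leq_trans (isT : 0 < 7)%N n7) r0).
  apply: (is_derive_eq (is_deriveB D1 D2)).
  (* On the sphere of radius [r] the three factors [sqnorm] amount to [r^6], whence the split of the
     exponent [n - 1] into [(n - 7) + 6]. *)
  have QE : r ^+ 6 * smean (gradlap2 v) r = smean Q r by rewrite /Q !smean_sqnorm; ring.
  have n6E : (n - 6)%N = (n - 7).+1 by lia.
  have n1E : n.-1 = ((n - 7) + 6)%N by lia.
  have nR : (n - 7).+1%:R = n%:R - 6 :> R by rewrite -n6E natrB//; lia.
  rewrite n1E n6E -[_ *: _]/(_ * _) exprD exprS/= nR -(mulrA (r ^+ _) (r ^+ 6)) QE.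
  have := smean_flux r v3; rewrite -/Q => FE.
  have -> : smean (euler G) r = 2 * ((n%:R - 6) * smean (boundary_flux v) r).
    by rewrite /G eulerB smeanB eulerMn smean_nat -FE.
  have -> : smean G r = smean Q r - 2 * smean (boundary_flux v) r.
    by rewrite /G smeanB smean_nat.
  by field; rewrite gt_eqF.
suff : phi l = 0 by move/eqP; rewrite subr_eq0 => /eqP.
have [M1 M10 GM] := smean_bounded G 1.
have [M2 M20 hM] := ball_integral_cvg0 (gradlap2 v).
(* Since [n - 6 >= 1], both terms of [phi] are [O(s)]; a constant function with this bound is 0. *)
have phiM s : 0 < s -> s <= 1 -> `|phi s| <= s * (M1 + (n%:R - 6) * M2).
  move=> s0 s1.
  have n60 : 0 <= n%:R - 6 :> R by rewrite subr_ge0 ler_nat; lia.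
  have sk k : (0 < k)%N -> s ^+ k <= s.
    by move=> k0; rewrite -[leRHS]expr1; apply: ler_wiXn2l => //; exact: ltW.
  apply: (le_trans (ler_normB _ _)); rewrite mulrDr lerD//.
    rewrite normrM ler_pM//; last by apply: GM; rewrite gtr0_norm.
    rewrite ger0_norm; first by apply: sk; lia.
    exact/exprn_ge0/ltW.
  rewrite normrM (ger0_norm n60) mulrCA ler_wpM2l//.
  by apply: (le_trans (hM s s0 s1)); rewrite ler_wpM2r// sk//; lia.
apply/eqP; rewrite -normr_le0; apply/ler_addgt0Pr => e e0; rewrite add0r.
set K := M1 + (n%:R - 6) * M2 in phiM.
have K0 : 0 <= K by rewrite addr_ge0// mulr_ge0// subr_ge0 ler_nat; lia.
(* The radius is small enough for [phiM], below [l], and makes the bound at most [e]; [K + 1] guards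
   against [K = 0]. *)
pose s := Num.min (Num.min 1 l) (e / (K + 1)).
have K1 : 0 < K + 1 by rewrite ltr_wpDl.
have s0 : 0 < s by rewrite !lt_min ltr01 l0 divr_gt0.
have s1 : s <= 1 by rewrite /s !ge_min lexx.
have sl : s <= l by rewrite /s !ge_min lexx orbT.
have se : s <= e / (K + 1) by rewrite /s !ge_min lexx orbT.
rewrite (constant_of_derive0 s0 sl phiD) (le_trans (phiM s s0 s1))//.
apply: (@le_trans _ _ (e / (K + 1) * K)); first by rewrite ler_wpM2r.
by rewrite mulrAC ler_pdivrMr// [leRHS]mulrDr mulr1 lerDl ltW.
Qed.

(** For positive radii [ball_energy] turns the rescaled volume term into a spherical mean divided by
    [2 (n - 6)], and [smean_flux] evaluates the derivative of that mean. *)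
Lemma is_derive_ball_energy v l : slap (slap (slap v)) = 0 -> 0 < l ->
  is_derive l 1 (fun r => r ^ (6 - n%:Z) * \int[leb]_(z in eball 0 r) (2^-1 * gradlap2 v z))
    (l^-1 * smean (boundary_flux v) l).
Proof.
move=> v3 l0.
have n60 : n%:R - 6 != 0 :> R by rewrite subr_eq0 eqr_nat; lia.
set Q := sqnorm * (sqnorm * (sqnorm * gradlap2 v)).
set G := Q - 2 * boundary_flux v.
have D : is_derive l 1 ((2 * (n%:R - 6))^-1 \*: smean G) (l^-1 * smean (boundary_flux v) l).
  have := is_deriveZ ((2 * (n%:R - 6))^-1) (is_derive_smean G l0).
  have := smean_flux l v3; rewrite -/Q => FE.
  have -> : smean (euler G) l = 2 * ((n%:R - 6) * smean (boundary_flux v) l).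
    by rewrite /G eulerB smeanB eulerMn smean_nat -FE.
  rewrite (_ : _ *: _ = l^-1 * smean (boundary_flux v) l)//.
  rewrite -[LHS]/(_ * _); field; rewrite gt_eqF//.
apply: near_eq_is_derive D.
have : nbhs l [set r | 0 < r] by exact: lt_nbhsr.
apply: filterS => r /= r0.
rewrite (RintegralZl _ (measurable_eball 0 r)); last first.
  by apply: (@integrable_eball _ _ _ r) => //; exact: measurable_eball.
have E := ball_energy v3 r0; rewrite -/Q -/G in E.
have -> : 6 - n%:Z = - (n - 6)%N%:Z by lia.
rewrite -exprnN -[LHS]/(_ * _).
have rk0 : r ^+ (n - 6) != 0 by rewrite expf_neq0// gt_eqF.
have -> : smean G r = (n%:R - 6) * (\int[leb]_(z in eball 0 r) gradlap2 v z) / r ^+ (n - 6).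
  by rewrite E mulrC mulKf.
move: (\int[leb]_(z in eball 0 r) gradlap2 v z) (r ^+ (n - 6)) rk0 => I k k0.
by field; rewrite k0 n60.
Qed.

End energy.

(** * The boundary density *)

Section boundary.
Context {R : realType} {n : nat}.
Local Notation A := (smoothFun R n).
Local Notation leb := (@lebesgue_rV R n).
Implicit Types (f g h v : A) (l r t : R) (x y z : 'rV[R]_n).
Local Notation N := (n%:R : A).

Lemma euler_affine t f : euler (affine 0 t f) = affine 0 t (euler f).
Proof.
apply: smooth_eqP => y; rewrite affine0E /euler !smooth_sum; apply: eq_bigr => i _.
by rewrite !smoothM pd_affine smoothM affine0E smooth_sconst /= mxE; ring.
Qed.

Lemma affineE x t f y : affine x t f y = f (x + t *: y). Proof. by []. Qed.

Lemma slap_affine x t f : slap (affine x t f) = sconst (t ^+ 2) * affine x t (slap f).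
Proof.
apply: smooth_eqP => y; rewrite smoothM smooth_sconst.
rewrite affineE /slap !smooth_sum mulr_sumr.
apply: eq_bigr => i _; rewrite pd_affine pdM pd_sconst pd_affine !smoothE !affineE; ring.
Qed.

Lemma sqnormZ t y : (sqnorm : A) (t *: y) = t ^+ 2 * (sqnorm : A) y.
Proof. by rewrite !sqnormE -!enorm_sqr enormZ exprMn real_normK ?num_real. Qed.

Lemma sphlap_affine t f : sphlap (affine 0 t f) = affine 0 t (sphlap f).
Proof.
apply: smooth_eqP => y; rewrite affine0E !sphlapE !euler_affine slap_affine !smoothE.
by rewrite !affine0E sqnormZ; ring.
Qed.

Lemma sphgrad2_affine t f g :
  sphgrad2 (affine 0 t f) (affine 0 t g) = affine 0 t (sphgrad2 f g).
Proof.
apply: smooth_eqP => y; rewrite affine0E !sphgrad2E !euler_affine !smoothE !affine0E sqnormZ.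
congr (_ - _); rewrite !smooth_sum [t ^+ 2 * _]mulrC -mulrA; congr (_ * _).
rewrite mulr_sumr; apply: eq_bigr => i _.
by rewrite !pd_affine !smoothE !affine0E; ring.
Qed.

Lemma edot_grad g y : edot (grad g y) y = euler g y.
Proof.
rewrite /edot /euler smooth_sum; apply: eq_bigr => i _.
by rewrite mxE smoothM mulrC.
Qed.

Lemma sphere_grad_coor g y i :
  sphere_grad g y ord0 i = (pd i g - scoor i * euler g) y.
Proof. by rewrite /sphere_grad !mxE edot_grad !smoothE mulrC. Qed.

(** [sphere_grad] has the coordinates [d_i g - y_i E g], which are smooth on the whole space, so
    both sides are algebraic expressions that agree once [|y|^2 = 1]. *)
Lemma sphere_laplacianE g y : enorm y = 1 -> sphere_laplacian g y = sphlap g y.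
Proof.
move=> y1; have q1 : (sqnorm : A) y = 1 by rewrite sqnormE -enorm_sqr y1 expr1n.
transitivity ((\sum_i (pd i (pd i g - scoor i * euler g)
    - scoor i * euler (pd i g - scoor i * euler g)) : A) y).
  rewrite smooth_sum; apply: eq_bigr => i _; rewrite -sphere_grad_coor.
  by congr (sphere_grad _ y ord0 i); apply/funext => z; rewrite sphere_grad_coor.
have E i : pd i (pd i g - scoor i * euler g) - scoor i * euler (pd i g - scoor i * euler g)
   = pd i (pd i g) - euler g - 2 * (scoor i * pd i (euler g)) + scoor i * pd i g
   + (scoor i * scoor i) * (euler g + euler (euler g)).
  rewrite raddfB/= pdM pd_coor eqxx/= eulerB eulerM pd_euler.
  have -> : euler (scoor i : A) = scoor i.
    rewrite -[RHS](sum_delta i scoor); apply: eq_bigr => j _.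
    by rewrite pd_coor eq_sym mulrC.
  by ring.
have -> : \sum_i (pd i (pd i g - scoor i * euler g)
    - scoor i * euler (pd i g - scoor i * euler g))
  = slap g - N * euler g - 2 * euler (euler g) + euler g
    + sqnorm * (euler g + euler (euler g)).
  under eq_bigr => i _ do rewrite E.
  rewrite !big_split/= !sumrN -mulr_suml -mulr_sumr -/(euler g) -/(euler (euler g)) -/sqnorm.
  by rewrite sumr_const card_ord -/(slap g) -mulr_natl; ring.
by rewrite sphlapE !smoothE q1; ring.
Qed.

Lemma enorm_sphere_grad g y : enorm y = 1 ->
  enorm (sphere_grad g y) ^+ 2 = sphgrad2 g g y.
Proof.
move=> y1; have q1 : (sqnorm : A) y = 1 by rewrite sqnormE -enorm_sqr y1 expr1n.
rewrite enorm_sqr /edot.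
under eq_bigr => i _ do rewrite sphere_grad_coor -smoothM.
rewrite -smooth_sum.
have E i : (pd i g - scoor i * euler g) * (pd i g - scoor i * euler g) =
   pd i g * pd i g - 2 * euler g * (scoor i * pd i g)
   + scoor i * scoor i * (euler g * euler g) by ring.
have -> : \sum_i (pd i g - scoor i * euler g) * (pd i g - scoor i * euler g)
  = \sum_i pd i g * pd i g - 2 * (euler g * euler g) + sqnorm * (euler g * euler g).
  under eq_bigr => i _ do rewrite E.
  by rewrite !big_split/= !sumrN -mulr_suml -mulr_sumr -/(euler g) -/sqnorm; ring.
by rewrite sphgrad2E !smoothE q1; ring.
Qed.

Lemma laplacianE f y : laplacian f y = slap f y.
Proof. by rewrite /laplacian /slap smooth_sum. Qed.

(** The falling factorial [E (E-1) ... (E-k+1)] applied to [v], that is, [lambda^k d^k/dlambda^k]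
    along rays. *)
Fixpoint ffall (k : nat) v : A :=
  if k is j.+1 then euler (ffall j v) - j%:R * ffall j v else v.

Lemma is_derive_inv_exp (k : nat) t : t != 0 ->
  is_derive t 1 (fun s : R => s^-1 ^+ k) (- k%:R * t^-1 ^+ k.+1).
Proof.
move=> t0.
have D : is_derive t 1 (fun s : R => s^-1) (- t^-1 ^+ 2).
  apply: DeriveDef; first exact: (derivableV (f := id)).
  by rewrite (deriveV (f := id))// derive_id -[_ *: _]/(_ * _) mulr1 exprVn.
have := is_deriveX k D.
rewrite (_ : _ ^+ k = (fun s : R => s^-1 ^+ k)); last first.
  by apply/funext => s; elim: k => [|k IH]; rewrite ?expr0// !exprS -IH.
move=> /is_derive_eq; apply.
by case: k => [|k]; rewrite -[_ *: _]/(_ * _) ?mul0r ?oppr0 ?mul0r// !exprS; ring.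
Qed.

Lemma is_derive_inv_exp_radial k f t y : t != 0 ->
  is_derive t 1 (fun s : R => s^-1 ^+ k * f (s *: y))
    (t^-1 ^+ k.+1 * (euler f - k%:R * f) (t *: y)).
Proof.
move=> t0.
apply: (is_derive_eq (is_deriveM (is_derive_inv_exp k t0) (is_derive_radial f y t0))).
by rewrite -[_ *: (_ * _)]/(_ * _) -[f _ *: _]/(_ * _) !smoothE exprS; ring.
Qed.

(** The induction differentiates a formula known only for positive arguments, which form a
    neighborhood of [t]. *)
Lemma dlambdaE v k t y : 0 < t ->
  dlambda (fun s z => v (s *: z)) k t y = t^-1 ^+ k * ffall k v (t *: y).
Proof.
rewrite /dlambda; elim: k t => [|k IH] t t0; first by rewrite derive1n0 expr0 mul1r.
rewrite derive1nS derive1E.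
have [_ <-] := is_derive_inv_exp_radial k (ffall k v) y (lt0r_neq0 t0).
apply: near_eq_derive.
have : nbhs t [set r | 0 < r] by exact: lt_nbhsr.
by apply: filterS => r /= r0; rewrite IH.
Qed.

Local Notation d1 := (delta1 (R := R) (n := n)).
Local Notation d2 := (delta2 (R := R) (n := n)).

(** Every term of the boundary integrand is invariant under rescaling [lambda], so [lambda]
    disappears when derivatives are written with E. The 8 is 6 + 2, where 2 comes from
    differentiating the factor [lambda^-2] in [|grad_theta f'|^2]. *)
Definition boundary_density v : A :=
  let F k := ffall k v in
  dtri v * dtri v - F 4 * F 1%N + sconst 2 * (F 3 * F 2)
  - sconst (d1 - 6) * (F 3 * F 1%N)
  - sconst (24 - 6 * d1 + d2) * (F 2 * F 1%N)
  - sconst (9 * d1 - 3 * d2 - 36) * (F 1%N * F 1%N)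
  + sconst (d1 - 8) * (F 2 * F 2)
  + sconst 2 * (sphlap v * sphlap v) + sphlap v * euler (sphlap v)
  + sconst (4 * (n%:R - 4)) * sphgrad2 v v + sconst (n%:R - 4) * euler (sphgrad2 v v)
  - sconst 8 * sphgrad2 (F 1%N) (F 1%N) + euler (sphgrad2 (F 1%N) (F 1%N)).

(** A polynomial in plain scalars, so that the integrand at [lambda = l] and its normalized form at
    [lambda = 1] can be compared by [field]. *)
Definition boundary_formula l (w2 f1 f2 f3 f4 lap lap' nab nab' nab1 nab1' : R) : R :=
  w2 - l ^+ 5 * f4 * f1 + 2 * l ^+ 5 * f3 * f2
  - (d1 - 6) * l ^+ 4 * f3 * f1
  - (24 - 6 * d1 + d2) * l ^+ 3 * f2 * f1
  - (9 * d1 - 3 * d2 - 36) * l ^+ 2 * f1 ^+ 2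
  + (d1 - 8) * l ^+ 4 * f2 ^+ 2
  + 2 * lap + 2^-1 * l * lap' + 4 * (n%:R - 4) * nab + (n%:R - 4) * l * nab'
  - 6 * l ^+ 2 * nab1 + l ^+ 3 * nab1'.

Lemma boundary_densityE v z : boundary_density v z =
  boundary_formula 1 ((dtri v * dtri v) z) (ffall 1 v z) (ffall 2 v z) (ffall 3 v z)
    (ffall 4 v z) ((sphlap v * sphlap v) z) (euler (sphlap v * sphlap v) z)
    (sphgrad2 v v z) (euler (sphgrad2 v v) z) (sphgrad2 (ffall 1 v) (ffall 1 v) z)
    (euler (sphgrad2 (ffall 1 v) (ffall 1 v)) z - 2 * sphgrad2 (ffall 1 v) (ffall 1 v) z).
Proof.
have -> : boundary_density v z =
  dtri v z * dtri v z - ffall 4 v z * ffall 1 v z + 2 * (ffall 3 v z * ffall 2 v z)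
  - (d1 - 6) * (ffall 3 v z * ffall 1 v z)
  - (24 - 6 * d1 + d2) * (ffall 2 v z * ffall 1 v z)
  - (9 * d1 - 3 * d2 - 36) * (ffall 1 v z * ffall 1 v z)
  + (d1 - 8) * (ffall 2 v z * ffall 2 v z)
  + 2 * (sphlap v z * sphlap v z) + sphlap v z * euler (sphlap v) z
  + (4 * (n%:R - 4)) * sphgrad2 v v z + (n%:R - 4) * euler (sphgrad2 v v) z
  - 8 * sphgrad2 (ffall 1 v) (ffall 1 v) z
  + euler (sphgrad2 (ffall 1 v) (ffall 1 v)) z by [].
have -> : euler (sphlap v * sphlap v) z = 2 * (sphlap v z * euler (sphlap v) z).
  by rewrite eulerM smoothD !smoothM; ring.
have -> : (dtri v * dtri v) z = dtri v z * dtri v z by [].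
have -> : (sphlap v * sphlap v) z = sphlap v z * sphlap v z by [].
rewrite /boundary_formula expr1n.
move: (euler (sphgrad2 (ffall 1 v) _) z) (sphgrad2 (ffall 1 v) _ z).
move: (euler (sphgrad2 v v) z) (sphgrad2 v v z) (euler (sphlap v) z) (sphlap v z).
move: (ffall 4 v z) (ffall 3 v z) (ffall 2 v z) (ffall 1 v z) (dtri v z) d1 d2 (n%:R : R).
by move=> *; field.
Qed.

Lemma Einf_boundaryE (u : 'rV[R]_n -> R) x v l y :
  (forall z, u (x + z) = v z) -> 0 < l -> enorm y = 1 ->
  Einf_boundary u x l y = boundary_density v (l *: y).
Proof.
move=> uv l0 y1; have ln0 := lt0r_neq0 l0.
have bE : blowup u x = fun s z => v (s *: z).
  by apply/funext => s; apply/funext => z; rewrite /blowup uv.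
have bA s : (fun z => v (s *: z)) = affine 0 s v.
  by apply/funext => z; rewrite affine0E.
have lapE : (fun t => sphere_laplacian (blowup u x t) y ^+ 2) =
    (fun t => (sphlap v * sphlap v) (t *: y)).
  apply/funext => t; rewrite bE bA sphere_laplacianE// sphlap_affine affine0E.
  by rewrite smoothM expr2.
have nabE : (fun t => enorm (sphere_grad (blowup u x t) y) ^+ 2) =
    (fun t => sphgrad2 v v (t *: y)).
  by apply/funext => t; rewrite bE bA enorm_sphere_grad// sphgrad2_affine affine0E.
have nab'E t : 0 < t ->
    enorm (sphere_grad (dlambda (blowup u x) 1 t) y) ^+ 2 =
    t^-1 ^+ 2 * sphgrad2 (euler v) (euler v) (t *: y).
  move=> t0.
  have -> : dlambda (blowup u x) 1 t = (sconst t^-1 * affine 0 t (euler v) : A).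
    apply/funext => z; rewrite bE dlambdaE// smoothM smooth_sconst affine0E expr1.
    by rewrite /= mul0r subr0.
  have Es c f : sphgrad2 (sconst c * f) (sconst c * f) = sconst (c ^+ 2) * sphgrad2 f f.
    have -> : sconst (c ^+ 2) = sconst c * sconst c :> A.
      by apply: smooth_eqP => z; rewrite smoothM !smooth_sconst expr2.
    rewrite !sphgrad2E !eulerM euler_sconst.
    have -> : \sum_i pd i (sconst c * f) * pd i (sconst c * f) =
        sconst c * sconst c * \sum_i pd i f * pd i f.
      by rewrite mulr_sumr; apply: eq_bigr => i _; rewrite pdM pd_sconst; ring.
    ring.
  by rewrite enorm_sphere_grad// Es smoothM smooth_sconst sphgrad2_affine affine0E.
have dlap : derive1 (fun t => sphere_laplacian (blowup u x t) y ^+ 2) l =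
    l^-1 * (euler (sphlap v * sphlap v)) (l *: y).
  by rewrite lapE derive1E; have [_ ->] := is_derive_radial (sphlap v * sphlap v) y ln0.
have dnab : derive1 (fun t => enorm (sphere_grad (blowup u x t) y) ^+ 2) l =
    l^-1 * (euler (sphgrad2 v v)) (l *: y).
  by rewrite nabE derive1E; have [_ ->] := is_derive_radial (sphgrad2 v v) y ln0.
have dnab' : derive1 (fun t => enorm (sphere_grad (dlambda (blowup u x) 1 t) y) ^+ 2) l =
    l^-1 ^+ 3 * (euler (sphgrad2 (euler v) (euler v)) - 2 * sphgrad2 (euler v) (euler v)) (l *: y).
  rewrite derive1E.
  have [_ <-] := is_derive_inv_exp_radial 2 (sphgrad2 (euler v) (euler v)) y ln0.
  apply: near_eq_derive.
  have : nbhs l [set r | 0 < r] by exact: lt_nbhsr.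
  by apply: filterS => r /= r0; rewrite nab'E.
have lapl : laplacian (blowup u x l) y ^+ 2 = (dtri v * dtri v) (l *: y).
  rewrite bE bA laplacianE slap_affine smoothM smooth_sconst affine0E.
  by rewrite smoothM /dtri smoothM sqnorm_scaled// expr2.
have dl1 : dlambda (blowup u x) 1 l y = l^-1 * euler v (l *: y).
  by rewrite bE dlambdaE// expr1 /= mul0r subr0.
have dk k : dlambda (blowup u x) k l y = l^-1 ^+ k * ffall k v (l *: y).
  by rewrite bE dlambdaE.
transitivity (boundary_formula l ((dtri v * dtri v) (l *: y))
  (l^-1 * euler v (l *: y)) (l^-1 ^+ 2 * ffall 2 v (l *: y))
  (l^-1 ^+ 3 * ffall 3 v (l *: y)) (l^-1 ^+ 4 * ffall 4 v (l *: y))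
  ((sphlap v * sphlap v) (l *: y)) (l^-1 * (euler (sphlap v * sphlap v)) (l *: y))
  (sphgrad2 v v (l *: y)) (l^-1 * (euler (sphgrad2 v v)) (l *: y))
  (l^-1 ^+ 2 * sphgrad2 (euler v) (euler v) (l *: y))
  (l^-1 ^+ 3 * (euler (sphgrad2 (euler v) (euler v)) - 2 * sphgrad2 (euler v) (euler v)) (l *: y))).
  rewrite -lapl -dl1 -(dk 2%N) -(dk 3%N) -(dk 4%N) -dlap -dnab -(nab'E l l0) -dnab'.
  by rewrite -(congr1 (fun w => w l) lapE) -(congr1 (fun w => w l) nabE).
rewrite boundary_densityE /boundary_formula expr1n.
rewrite (_ : ffall 1 v = euler v); last by rewrite /= mul0r subr0.
have -> : (euler (sphgrad2 (euler v) (euler v)) - 2 * sphgrad2 (euler v) (euler v)) (l *: y)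
  = euler (sphgrad2 (euler v) (euler v)) (l *: y) - 2 * sphgrad2 (euler v) (euler v) (l *: y).
  by rewrite smoothD smoothN smoothM smooth_nat.
move: (euler (sphgrad2 (euler v) (euler v)) _) (sphgrad2 (euler v) (euler v) _).
move: (euler (sphgrad2 v v) _) (sphgrad2 v v _) (euler (sphlap v * sphlap v) _).
move: ((sphlap v * sphlap v) _) (ffall 4 v _) (ffall 3 v _) (ffall 2 v _).
move: ((dtri v * dtri v) _) (euler v _) d1 d2 (n%:R : R) => *.
by field.
Qed.

End boundary.

(** * The dissipation *)

Section dissipation.
Context {R : realType} {n : nat}.
Local Notation A := (smoothFun R n).
Implicit Types (f g h v : A) (l r t : R) (x y z : 'rV[R]_n).
Local Notation N := (n%:R : A).

Definition green f g : A := sphgrad2 f g + f * sphlap g.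
Definition sphsym f g : A := f * sphlap g - g * sphlap f.

Lemma smean_green0 f g l : smean (green f g) l = 0.
Proof. exact: smean_green. Qed.

Lemma smean_sphsym f g l : smean (sphsym f g) l = 0.
Proof. by rewrite smeanB smean_sphlapC subrr. Qed.

Definition correction (al be ga : R) v : A :=
  sconst al * (euler v * euler v) + sconst be * (euler v * euler (euler v))
  + sconst ga * (euler (euler v) * euler (euler v)).

(** The weights enter through the Euler derivative of [correction], which is
    [2 al p q + be (q^2 + p r) + 2 ga q r]. Thus [al] and [ga] each control one cross term, while
    [be] trades [p r] against [q^2]. *)
Definition dissipation (al be ga : R) v : A :=
  let p := euler v in let q := euler p in let r := euler q in let s := sphlap p in
  sconst 3 * (r * r) + sconst (8 - be) * (p * r)
  + sconst (24 * n%:R - n%:R * n%:R - 60 - be) * (q * q)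
  + sconst (8 * n%:R * n%:R - 48 * n%:R + 64) * (p * p)
  + sconst (2 * n%:R - 16 - 2 * ga) * (q * r)
  + sconst (4 * n%:R * n%:R - 56 * n%:R + 140 - 2 * al) * (p * q)
  + sconst 2 * (r * s) + sconst 3 * (s * s)
  + (sconst (2 * 2) * sphgrad2 q q - sconst (2 * (n%:R + 2)) * sphgrad2 q p
     + sconst (12 * n%:R - 48) * sphgrad2 p p).

(* The combination of Green's formulas which brings the integrand to the form
   [dissipation]; it is determined by comparing coefficients. *)
Definition null_terms v : A :=
  let p := euler v in let q := euler p in let r := euler q in
  sconst (8 * n%:R - 32) * green v p + sconst (2 * n%:R - 8) * green v q
  + sconst (40 - 10 * n%:R) * green p p + sconst (2 * n%:R - 12) * green p q
  + sconst 2 * green p r - sconst 2 * green q q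
  + sconst (8 * n%:R - 32) * sphsym p v - sconst 4 * sphsym p (sphlap v)
  + sphsym p (sphlap p) + sconst (2 * n%:R - 8) * sphsym q v
  + sconst 4 * sphsym q p - sphsym q (sphlap v).

Lemma smean_null_terms v l : smean (null_terms v) l = 0.
Proof.
rewrite /null_terms.
rewrite !(smeanD, smeanN, smeanZ, smean_green0, smean_sphsym); ring.
Qed.

Lemma eulerN f : euler (- f) = - euler f. Proof. exact: raddfN. Qed.

Lemma euler_boundary_density v :
  let F k := ffall k v in let F' k := euler (ffall k v) in
  euler (boundary_density v) =
  2 * (dtri v * euler (dtri v)) - (F' 4 * F 1%N + F 4 * F' 1%N)
  + 2 * (F' 3 * F 2 + F 3 * F' 2)
  - (2 * (N - 1) - 6) * (F' 3 * F 1%N + F 3 * F' 1%N)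
  - (24 - 6 * (2 * (N - 1)) + (N - 1) * (N - 3)) * (F' 2 * F 1%N + F 2 * F' 1%N)
  - (9 * (2 * (N - 1)) - 3 * ((N - 1) * (N - 3)) - 36) * (2 * (F 1%N * F' 1%N))
  + (2 * (N - 1) - 8) * (2 * (F 2 * F' 2))
  + 4 * (sphlap v * euler (sphlap v)) + euler (sphlap v) * euler (sphlap v)
  + sphlap v * euler (euler (sphlap v))
  + 4 * (N - 4) * euler (sphgrad2 v v) + (N - 4) * euler (euler (sphgrad2 v v))
  - 8 * euler (sphgrad2 (F 1%N) (F 1%N)) + euler (euler (sphgrad2 (F 1%N) (F 1%N))).
Proof.
cbv zeta; rewrite /boundary_density.
have -> : sconst (delta1 (n := n) - 6) = 2 * (N - 1) - 6 :> A.
  by rewrite /delta1; ring.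
have -> : sconst (24 - 6 * delta1 (n := n) + delta2 (n := n)) =
    24 - 6 * (2 * (N - 1)) + (N - 1) * (N - 3) :> A.
  by rewrite /delta1 /delta2; ring.
have -> : sconst (9 * delta1 (n := n) - 3 * delta2 (n := n) - 36) =
    9 * (2 * (N - 1)) - 3 * ((N - 1) * (N - 3)) - 36 :> A.
  by rewrite /delta1 /delta2; ring.
have -> : sconst (delta1 (n := n) - 8) = 2 * (N - 1) - 8 :> A.
  by rewrite /delta1; ring.
have -> : sconst (4 * (n%:R - 4)) = 4 * (N - 4) :> A by ring.
have -> : sconst (n%:R - 4) = N - 4 :> A by ring.
rewrite !rmorph_nat.
have N1 : euler (N - 1) = 0 by rewrite eulerB (euler_nat 1) euler_nat subrr.
have N3 : euler (N - 3) = 0 by rewrite eulerB !euler_nat subrr.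
have N4 : euler (N - 4) = 0 by rewrite eulerB !euler_nat subrr.
move: (ffall 1 v) (ffall 2 v) (ffall 3 v) (ffall 4 v) (dtri v) (sphlap v) => F1 F2 F3 F4 W b0.
move: (sphgrad2 v v) (sphgrad2 F1 F1) => g00 g11.
have d6 : euler (2 * (N - 1) - 6) = 0.
  by rewrite eulerB eulerM N1 !euler_nat; ring.
have d24 : euler (24 - 6 * (2 * (N - 1)) + (N - 1) * (N - 3)) = 0.
  by rewrite eulerD eulerB !eulerM N1 N3 !euler_nat; ring.
have d36 : euler (9 * (2 * (N - 1)) - 3 * ((N - 1) * (N - 3)) - 36) = 0.
  by rewrite !eulerB !eulerM N1 N3 !euler_nat; ring.
have d8 : euler (2 * (N - 1) - 8) = 0.
  by rewrite eulerB eulerM N1 !euler_nat; ring.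
(* The coefficients become opaque functions annihilated by [euler], so that the Leibniz rule does
   not expand them. *)
move: (2 * (N - 1) - 6) d6 (24 - 6 * (2 * (N - 1)) + (N - 1) * (N - 3)) d24
 (9 * (2 * (N - 1)) - 3 * ((N - 1) * (N - 3)) - 36) d36 (2 * (N - 1) - 8) d8
 (N - 4) N4 => k1 k1' k2 k2' k3 k3' k4 k4' k6 k6'.
rewrite !(eulerD, eulerN, eulerM, euler_nat) k1' k2' k3' k4' k6'; ring.
Qed.

(** Since E and L commute, both sides reduce to polynomials in iterates [E^k v], their images under
    L and its square, and the tangential products of these iterates. The rewriting brings every term
    to such atoms, and [ring] compares coefficients. *)
Lemma flux_dissipation al be ga v :
  boundary_flux v + euler (boundary_density v - correction al be ga v)
  = dissipation al be ga v + null_terms v.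
Proof.
have M k : euler (N - k%:R) = 0 by rewrite eulerB !euler_nat subrr.
have EM k f : euler ((N - k%:R) * f) = (N - k%:R) * euler f.
  by rewrite eulerM M mul0r add0r.
have LM k f : sphlap ((N - k%:R) * f) = (N - k%:R) * sphlap f.
  by rewrite !mulrBl sphlapB !sphlapMn.
have w1 : dtri v = euler (euler v) + (N - 2) * euler v + sphlap v.
  by rewrite /dtri sqnorm_slap.
have w2 := sqnorm_slap2 (slap v); rewrite -/(dtri2 v) -/(dtri v) in w2.
rewrite eulerB euler_boundary_density.
have F1 : ffall 1 v = euler v by rewrite /= mul0r subr0.
have F2 : ffall 2 v = euler (euler v) - euler v.
  by rewrite -[LHS]/(euler (ffall 1 v) - 1%:R * ffall 1 v) F1; ring.
have F3 : ffall 3 v = euler (euler (euler v)) - 3 * euler (euler v) + 2 * euler v.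
  by rewrite -[LHS]/(euler (ffall 2 v) - 2%:R * ffall 2 v) F2 eulerB; ring.
have F4 : ffall 4 v = euler (euler (euler (euler v))) - 6 * euler (euler (euler v))
    + 11 * euler (euler v) - 6 * euler v.
  rewrite -[LHS]/(euler (ffall 3 v) - 3%:R * ffall 3 v) F3 eulerD eulerB !eulerMn; ring.
have F2' : euler (ffall 2 v) = euler (euler (euler v)) - euler (euler v) by rewrite F2 eulerB.
have F3' : euler (ffall 3 v) = euler (euler (euler (euler v)))
    - 3 * euler (euler (euler v)) + 2 * euler (euler v).
  by rewrite F3 eulerD eulerB !eulerMn.
have F4' : euler (ffall 4 v) = euler (euler (euler (euler (euler v))))
    - 6 * euler (euler (euler (euler v))) + 11 * euler (euler (euler v)) - 6 * euler (euler v).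
  by rewrite F4 eulerB eulerD eulerB !eulerMn.
rewrite F2' F3' F4' F1 F2 F3 F4 {F1 F2 F3 F4 F2' F3' F4'}.
rewrite !euler_sphgrad2 !eulerD !euler_sphgrad2 !euler_sphlap.
rewrite /boundary_flux /correction /null_terms /dissipation /green /sphsym.
have z1 : euler (dtri v) = euler (euler (euler v)) + (N - 2) * euler (euler v) + sphlap (euler v).
  by rewrite w1 !eulerD EM euler_sphlap.
have z2 : euler (euler (dtri v)) = euler (euler (euler (euler v)))
    + (N - 2) * euler (euler (euler v)) + sphlap (euler (euler v)).
  by rewrite z1 !eulerD EM euler_sphlap.
have z3 : euler (euler (euler (dtri v))) = euler (euler (euler (euler (euler v))))
    + (N - 2) * euler (euler (euler (euler v))) + sphlap (euler (euler (euler v))).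
  by rewrite z2 !eulerD EM euler_sphlap.
have y0 : sphlap (dtri v) = sphlap (euler (euler v)) + (N - 2) * sphlap (euler v)
    + sphlap (sphlap v) by rewrite w1 !sphlapD LM.
have y1 : sphlap (euler (dtri v)) = sphlap (euler (euler (euler v)))
    + (N - 2) * sphlap (euler (euler v)) + sphlap (sphlap (euler v)).
  by rewrite z1 !sphlapD LM.
have w2' : euler (dtri2 v) = euler (euler (euler (dtri v))) + (N - 6) * euler (euler (dtri v))
    - 2 * (N - 4) * euler (dtri v) + sphlap (euler (dtri v)).
  rewrite w2 eulerD eulerB eulerD EM euler_sphlap -mulrA eulerMn EM; ring.
rewrite w2' w2 z3 z2 y1 y0 z1 w1 {w2' w2 z3 z2 y1 y0 z1 w1 M EM LM}.
rewrite (sphgrad2C (euler (euler v)) v) (sphgrad2C (euler v) v)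
  (sphgrad2C (euler (euler v)) (euler v)) (sphgrad2C (euler (euler (euler v))) (euler v)).
rewrite !eulerM !euler_sconst.
move: (sphgrad2 v (euler (euler v))) (sphgrad2 v (euler v)) (sphgrad2 (euler v) (euler (euler v)))
  (sphgrad2 (euler v) (euler (euler (euler v)))) (sphgrad2 (euler v) (euler v))
  (sphgrad2 (euler (euler v)) (euler (euler v))) => g02 g01 g12 g13 g11 g22.
move: (sphlap (sphlap (euler v))) (sphlap (sphlap v)) => c1 c0.
move: (sphlap (euler (euler (euler v)))) (sphlap (euler (euler v))) (sphlap (euler v)) (sphlap v)
  => b3 b2 b1 b0.
move: (euler (euler (euler (euler (euler v))))) (euler (euler (euler (euler v)))) => a5 a4.
move: (euler (euler (euler v))) (euler (euler v)) (euler v) => a3 a2 a1.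
ring.
Qed.

End dissipation.

(** * Pointwise positivity of the dissipation *)

Section positivity.
Context {R : realType} {n : nat}.
Local Notation A := (smoothFun R n).
Implicit Types (f g h v : A) (l r t : R) (x y z : 'rV[R]_n).

(** It is half a sum of squares of rotation derivatives. *)
Lemma sphgrad2_ge0 f y : 0 <= sphgrad2 f f y.
Proof.
have /(congr1 (fun h : A => h y)) := sum_angular_prod f f.
rewrite smoothM smooth_nat => E; rewrite -(pmulr_rge0 _ (ltr0Sn R 1)) -E.
rewrite smooth_sum; apply: sumr_ge0 => i _; rewrite smooth_sum; apply: sumr_ge0 => j _.
by rewrite smoothM -expr2 sqr_ge0.
Qed.

Lemma sphgrad2_comb (a b : R) f g :
  sphgrad2 (sconst a * f - sconst b * g) (sconst a * f - sconst b * g) =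
  sconst a * sconst a * sphgrad2 f f - 2 * (sconst a * sconst b) * sphgrad2 f g
  + sconst b * sconst b * sphgrad2 g g.
Proof.
rewrite !sphgrad2E !eulerB !eulerM !euler_sconst.
have E i : pd i (sconst a * f - sconst b * g) * pd i (sconst a * f - sconst b * g) =
    sconst a * sconst a * (pd i f * pd i f)
    + - (2 * (sconst a * sconst b)) * (pd i f * pd i g)
    + sconst b * sconst b * (pd i g * pd i g).
  by rewrite raddfB/= !pdM !pd_sconst; ring.
under eq_bigr => i _ do rewrite E.
rewrite !big_split/= -!mulr_sumr; ring.
Qed.

(** Completing the square: the form is the squared tangential gradient of [a f - (k / a) g] plus
    [c - k^2 / a^2] times that of [g]. *)
Lemma gradient_form_ge0 (a k c : R) f g y : k ^+ 2 <= a * a * c -> a != 0 ->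
  0 <= a * a * sphgrad2 f f y - 2 * k * sphgrad2 f g y + c * sphgrad2 g g y.
Proof.
move=> kac a0.
have := sphgrad2_ge0 (sconst a * f - sconst (k / a) * g) y.
rewrite sphgrad2_comb.
have -> : (sconst a * sconst a * sphgrad2 f f - 2 * (sconst a * sconst (k / a)) * sphgrad2 f g
  + sconst (k / a) * sconst (k / a) * sphgrad2 g g) y =
  a * a * sphgrad2 f f y - 2%R * (a * (k / a)) * sphgrad2 f g y
  + k / a * (k / a) * sphgrad2 g g y.
  by rewrite -[2%R in RHS](smooth_nat 2 y).
move: (sphgrad2_ge0 g y); move: (sphgrad2 f f y) (sphgrad2 f g y) (sphgrad2 g g y) => gff gfg ggg.
move=> ggg0 le1; apply: (le_trans le1).
rewrite [a * (k / a)]mulrC divfK// lerD2l ler_wpM2r//.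
have a20 : 0 < a * a by rewrite -expr2 exprn_even_gt0.
by rewrite -!expr2 expr_div_n ler_pdivrMr// mulrC.
Qed.

(* The coefficient [t] of [p * r] must satisfy [t >= n^2 - 24 n + 68] and
   [3 t^2 / 32 <= 8 (n-2) (n-4) - 1]; this linear choice does for [7 <= n <= 30]. *)
Definition cross (N : R) := 28 / 3 * N - 31.

(* For these weights the [p * q] and [q * r] terms of the dissipation vanish. *)
Lemma le_dissipation v y : (7 <= n <= 30)%N ->
  euler v y * euler v y <=
  dissipation (70 - 28 * n%:R + 2 * n%:R ^+ 2) (8 - cross n%:R) (n%:R - 8) v y.
Proof.
move=> /andP[n7 n30].
have m7 : 7 <= n%:R :> R by rewrite ler_nat.
have m30 : n%:R <= 30 :> R by rewrite ler_nat.
have E (al be ga : R) : dissipation al be ga v y =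
  let p := euler v y in let q := euler (euler v) y in
  let r := euler (euler (euler v)) y in let s := sphlap (euler v) y in
  let N := n%:R : R in
  3 * (r * r) + (8 - be) * (p * r) + (24 * N - N * N - 60 - be) * (q * q)
  + (8 * N * N - 48 * N + 64) * (p * p) + (2 * N - 16 - 2 * ga) * (q * r)
  + (4 * N * N - 56 * N + 140 - 2 * al) * (p * q) + 2 * (r * s) + 3 * (s * s)
  + (2 * 2 * sphgrad2 (euler (euler v)) (euler (euler v)) y
     - 2 * (N + 2) * sphgrad2 (euler (euler v)) (euler v) y
     + (12 * N - 48) * sphgrad2 (euler v) (euler v) y) by [].
rewrite E; cbv zeta => {E}.
(* The gradient terms form a quadratic form of their own; its discriminant condition is
   [(n+2)^2 <= 48 (n-4)]. *)
have := @gradient_form_ge0 2 (n%:R + 2) (12 * n%:R - 48) (euler (euler v)) (euler v) y.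
move: (sphgrad2 (euler (euler v)) (euler (euler v)) y) (sphgrad2 (euler (euler v)) (euler v) y)
   (sphgrad2 (euler v) (euler v) y) (sphlap (euler v) y) (euler (euler (euler v)) y)
   (euler (euler v) y) (euler v y) => g22 g12 g11 s r q p.
rewrite /cross; move: (n%:R : R) m7 m30 => N m7 m30 H.
have {H} := H ltac:(nra) ltac:(by rewrite pnatr_eq0).
move: (_ + _ * g11) => G G0.
have q2 : 0 <= q * q by rewrite -expr2 sqr_ge0.
have p2 : 0 <= p * p by rewrite -expr2 sqr_ge0.
set th := 28 / 3 * N - 31.
(* [3 r^2 + th p r + 2 r s + 3 s^2] equals the two squares in [h3] minus [3 th^2 p^2 / 32]; [h1] and
   [h2] hold what is left for [q^2] and [p^2], the [- 1] being the claimed lower bound. At [n = 30]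
   the coefficient in [h1] is exactly 1. *)
have h1 : 0 <= (24 * N - N * N - 60 - 8 + th) * (q * q) by rewrite mulr_ge0// /th; nra.
have h2 : 0 <= (8 * N * N - 48 * N + 64 - 1 - 3 * th ^+ 2 / 32) * (p * p).
  by rewrite mulr_ge0// /th; nra.
have h3 : 0 <= 3 * (s + r / 3) ^+ 2 + 8 / 3 * (r + 3 * th * p / 16) ^+ 2.
  by rewrite addr_ge0// mulr_ge0 ?sqr_ge0//; lra.
rewrite -subr_ge0.
set D := (X in 0 <= X).
suff -> : D = G + (24 * N - N * N - 60 - 8 + th) * (q * q)
  + (8 * N * N - 48 * N + 64 - 1 - 3 * th ^+ 2 / 32) * (p * p)
  + (3 * (s + r / 3) ^+ 2 + 8 / 3 * (r + 3 * th * p / 16) ^+ 2).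
  exact: addr_ge0 (addr_ge0 (addr_ge0 G0 h1) h2) h3.
by rewrite /D; move: th {h1 h2 h3 D} => th; field.
Qed.

End positivity.

(** * The corrected energy at an arbitrary center *)

Section corrected_energy.
Context {R : realType} {n : nat}.
Local Notation A := (smoothFun R n).
Local Notation leb := (@lebesgue_rV R n).
Implicit Types (f g h v w : A) (u : 'rV[R]_n -> R) (l r t : R) (x y z : 'rV[R]_n).

Lemma gradlap2E w z : enorm (grad (laplacian w) z) ^+ 2 = gradlap2 w z.
Proof.
have -> : laplacian w = slap w by apply/funext => y; exact: laplacianE.
by rewrite enorm_sqr /gradlap2 smooth_sum; apply: eq_bigr => i _; rewrite !mxE.
Qed.

Lemma sconst_affine1 x f : sconst (1 ^+ 2) * affine x 1 f = affine x 1 f.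
Proof. by rewrite expr1n rmorph1 mul1r. Qed.

Lemma gradlap2_affine x w : gradlap2 (affine x 1 w) = affine x 1 (gradlap2 w).
Proof.
apply: smooth_eqP => y; rewrite affineE /gradlap2 !smooth_sum; apply: eq_bigr => i _.
by rewrite slap_affine sconst_affine1 pd_affine rmorph1 mul1r.
Qed.

Lemma slap3_affine x w : (forall y, iter 3 laplacian w y = 0) ->
  slap (slap (slap (affine x 1 w))) = 0.
Proof.
move=> w3; do 3 rewrite slap_affine sconst_affine1.
apply: smooth_eqP => y; rewrite affineE -[RHS](w3 (x + 1 *: y)) /=.
by do 2 rewrite (funext (laplacianE _)); rewrite laplacianE.
Qed.

Lemma ball_energy_affine x w l :
  \int[leb]_(z in eball x l) (2^-1 * enorm (grad (laplacian w) z) ^+ 2) =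
  \int[leb]_(z in eball 0 l) (2^-1 * gradlap2 (affine x 1 w) z).
Proof.
have ballE : affrV 1 x @^-1` eball x l = eball 0 l.
  by apply/seteqP; split=> z; rewrite /affrV /eball/= scale1r addrK subr0.
have -> : (fun z => 2^-1 * enorm (grad (laplacian w) z) ^+ 2) =
    (sconst 2^-1 * gradlap2 w : A).
  by apply/funext => z; rewrite gradlap2E smoothM.
have c := @smooth_fun_continuous R n (sconst 2^-1 * gradlap2 w).
rewrite (@Rintegral_transfer _ _ _ _ R leb leb _ (affrV 1 x) 1%:nng%R _
  (measurable_eball x l) (measurable_affrV 1 x) (continuous_measurable_rV c)).
- rewrite ballE mul1r; apply: eq_Rintegral => z _.
  by rewrite gradlap2_affine smoothM affineE /affrV addrC.
- by move=> B mB _; rewrite -[LHS](lebesgue_rV_aff x ltr01 mB) expr1n.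
rewrite ballE.
have -> : (sconst 2^-1 * gradlap2 w : A) \o affrV 1 x =
    affine x 1 (sconst 2^-1 * gradlap2 w) :> ('rV[R]_n -> R).
  by apply/funext => z; rewrite affineE /affrV/= addrC.
exact: integrable_eball (measurable_eball 0 l) (@subset_refl _ _).
Qed.

(* As [l^2 f'' = q - p], these are the coefficients for which the sum of the
   [c i j] terms is [al p^2 + be p q + ga q^2]. *)
Definition correction_coef (al be ga : R) (i j : nat) : R :=
  match i, j with
  | 1%N, 1%N => al + be + ga
  | 1%N, 2%N | 2%N, 1%N => (be + 2 * ga) / 2
  | 2%N, 2%N => ga
  | _, _ => 0
  end.

Lemma correction_coefE al be ga u x v l y : (forall z, u (x + z) = v z) -> 0 < l ->
  \sum_(i < 3) \sum_(j < 3) correction_coef al be ga i j * l ^+ (i + j)%N *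
    dlambda (blowup u x) i l y * dlambda (blowup u x) j l y =
  correction al be ga v (l *: y).
Proof.
move=> uv l0; have ln0 := lt0r_neq0 l0.
have bE : blowup u x = fun s z => v (s *: z).
  by apply/funext => s; apply/funext => z; rewrite /blowup uv.
have -> : correction al be ga v (l *: y) =
  al * (euler v (l *: y) * euler v (l *: y))
  + be * (euler v (l *: y) * euler (euler v) (l *: y))
  + ga * (euler (euler v) (l *: y) * euler (euler v) (l *: y)) by [].
have sum3 (G : nat -> R) : \sum_(i < 3) G i = G 0%N + G 1%N + G 2%N.
  by rewrite !big_ord_recr big_ord0 /= add0r.
pose d k := dlambda (blowup u x) k l y.
pose G i j := correction_coef al be ga i j * l ^+ (i + j)%N * d i * d j.
rewrite (sum3 (fun i => \sum_(j < 3) G i j)) !(sum3 (G _)) /G /=.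
have -> : d 1%N = l^-1 * euler v (l *: y).
  by rewrite /d bE dlambdaE//= mul0r subr0.
have -> : d 2%N = l^-1 ^+ 2 * (euler (euler v) (l *: y) - euler v (l *: y)).
  by rewrite /d bE dlambdaE//= !mul0r !subr0 mul1r.
move: (euler v (l *: y)) (euler (euler v) (l *: y)) (d 0%N) => p q d0.
by field.
Qed.

Lemma Einf_correctedE al be ga w x l : 0 < l ->
  Einf_corrected (fun i j => correction_coef al be ga i j) l x w =
  l ^ (6 - n%:Z) * (\int[leb]_(z in eball 0 l) (2^-1 * gradlap2 (affine x 1 w) z))
  + smean (boundary_density (affine x 1 w) - correction al be ga (affine x 1 w)) l.
Proof.
move=> l0; rewrite /Einf_corrected /Einf ball_energy_affine smeanB addrA.
have uv z : w (x + z) = affine x 1 w z by rewrite affineE scale1r.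
rewrite -!sphere_smean; congr (_ + _ - _); apply: eq_Rintegral => y.
  by rewrite inE /esphere/= subr0 => y1; apply: Einf_boundaryE.
by move=> _; rewrite (@correction_coefE _ _ _ _ _ (affine x 1 w)).
Qed.

Lemma is_derive_Einf_corrected al be ga w x l : (7 <= n)%N ->
  (forall y, iter 3 laplacian w y = 0) -> 0 < l ->
  is_derive l 1 (fun t : R => Einf_corrected (fun i j => correction_coef al be ga i j) t x w)
    (l^-1 * smean (dissipation al be ga (affine x 1 w)) l).
Proof.
move=> n7 w3 l0; set v := affine x 1 w.
have D := is_deriveD (is_derive_ball_energy n7 (slap3_affine x w3) l0)
  (is_derive_smean (boundary_density v - correction al be ga v) l0).
have E : l^-1 * smean (dissipation al be ga v) l =
  l^-1 * smean (boundary_flux v) l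
  + l^-1 * smean (euler (boundary_density v - correction al be ga v)) l.
  rewrite -mulrDr -smeanD flux_dissipation smeanD smean_null_terms addr0 //.
(* The expression through spherical means holds for positive radii only, which is enough near
   [l]. *)
rewrite E; apply: near_eq_is_derive D.
have : nbhs l [set r | 0 < r] by exact: lt_nbhsr.
by apply: filterS => r /= r0; rewrite Einf_correctedE.
Qed.

Lemma radial_derivativeE w x l y : 0 < l -> enorm y = 1 ->
  l * radial_derivative x w (x + l *: y) = euler (affine x 1 w) (l *: y).
Proof.
move=> l0 y1.
have [d1 d2] := smooth_c1 (smooth_funP w).
have [_ DE] := c1_differentiable d1 d2 (x + l *: y).
rewrite /radial_derivative DE.
rewrite addrAC subrr add0r.
have -> : udir (l *: y) = y by rewrite udirZ// /udir y1 invr1 scale1r.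
rewrite /euler smooth_sum mulr_sumr; apply: eq_bigr => i _.
rewrite pd_affine rmorph1 mul1r smoothM affineE scale1r mulrA.
by congr (_ * _); rewrite -[RHS]/((l *: y) ord0 i) mxE.
Qed.

(** The surface measure contributes [l^(n-1)], so the weight [l^-n] leaves the factor [1 / l] that
    the derivative of the energy also carries. *)
Lemma surface_integral_radial w x l : (0 < n)%N -> 0 < l ->
  l ^- n * surface_integral x l (fun z => (l * radial_derivative x w z) ^+ 2) =
  l^-1 * smean (euler (affine x 1 w) * euler (affine x 1 w)) l.
Proof.
move=> n0 l0; rewrite /surface_integral mulrA.
have -> : l ^- n * l ^+ n.-1 = l^-1.
  rewrite -{1}(prednK n0) exprS invfM mulrAC -mulrA divff ?mulr1//.
  by rewrite expf_neq0// gt_eqF.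
rewrite -sphere_smean; congr (_ * _); apply: eq_Rintegral => y.
by rewrite inE /esphere/= subr0 => y1; rewrite radial_derivativeE// smoothM expr2.
Qed.

End corrected_energy.

Theorem corollary2p1 (R : realType) (n : nat) (hn : (7 <= n <= 30)%N) :
  exists (c : 'I_3 -> 'I_3 -> R) (C : R),
    0 < C /\
    forall (u : 'rV[R]_n -> R),
      smooth u ->
      (forall y, iter 3 laplacian u y = 0) ->
      forall x : 'rV[R]_n,
        (forall l m : R, 0 < l -> l <= m ->
           Einf_corrected c l x u <= Einf_corrected c m x u) /\
        (forall l : R, 0 < l ->
           derivable (fun t : R => Einf_corrected c t x u) l 1 /\
           derive1 (fun t : R => Einf_corrected c t x u) l >=
             C * l ^- n *
             surface_integral x l
               (fun z => (l * radial_derivative x u z) ^+ 2)).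
Proof.
have /andP[n7 _] := hn.
(* [al] and [ga] are the zeros of the coefficients of [p q] and [q r] in [dissipation], and [be]
   makes the coefficient of [p r] equal to [cross n]. The constant [C = 1] is the factor of [p^2] in
   [le_dissipation]. *)
pose al : R := 70 - 28 * n%:R + 2 * n%:R ^+ 2.
pose be : R := 8 - cross n%:R.
pose ga : R := n%:R - 8.
exists (fun i j => correction_coef al be ga i j), 1; split=> // u su u3 x.
pose w := mk_smooth su; pose v := affine x 1 w.
have D (l : R) := @is_derive_Einf_corrected R n al be ga w x l n7 u3.
have le_D (l : R) : 0 < l -> l^-1 * smean (euler v * euler v) l <=
    l^-1 * smean (dissipation al be ga v) l.
  move=> l0; apply: ler_wpM2l; first by rewrite invr_ge0 ltW.
  by apply: le_smean => y _; rewrite smoothM; exact: le_dissipation.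
split=> [l m l0 lm|l l0].
  have [||c] := @MVT_segment R (fun t => Einf_corrected (fun i j => correction_coef al be ga i j) t x u)
    (fun t => t^-1 * smean (dissipation al be ga v) t) l m lm.
  - by move=> r; rewrite in_itv/= => /andP[lr _]; apply: D; exact: lt_trans lr.
  - apply: derivable_within_continuous => r; rewrite in_itv/= => /andP[lr _].
    by have [] := D r (lt_le_trans l0 lr).
  rewrite in_itv/= => /andP[lc _] E; rewrite -subr_ge0 E mulr_ge0 ?subr_ge0//.
  have c0 := lt_le_trans l0 lc.
  apply: le_trans (le_D c c0); apply: mulr_ge0; first by rewrite invr_ge0 ltW.
  by apply: smean_ge0 => y _; rewrite smoothM -expr2 sqr_ge0.
have [dl dE] := D l l0; split=> //.
rewrite derive1E dE mul1r.
have n0 : (0 < n)%N by exact: leq_trans n7.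
rewrite (surface_integral_radial w x n0 l0); exact: le_D.
Qed.
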